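(* Let $k$ be an algebraically closed field and let $R$ be a finite dimensional ideally ordered monomial $k$-algebra. Then $R$ is of finite representation type with $$E_R^{\mathrm{AUS}}\cong E_R$$ if and only if $R$ is self-injective.
   Context: Modules are finitely generated left modules; in a path algebra $kQ$ the product $pq$ is the path $q$ followed by the path $p$. A finite dimensional monomial algebra is a finite dimensional algebra $R=kQ/I$ with $Q$ a finite quiver and $I$ a two-sided ideal generated by paths; a monomial of $R$ is the class of a path (including lazy paths). $R$ is ideally ordered if for every primitive idempotent $e\in R$ and every pair of monomials $m,n\in eR$ there is an epimorphism of left $R$-modules $Rm\to Rn$ or an epimorphism $Rn\to Rm$. (For such $R$ there are only finitely many isomorphism classes of indecomposables in $\mathrm{sub}(R)$ below.) $\mathrm{sub}(R):=\operatorname{add}\{U\mid U\subseteq R^{\oplus n}\}$ ($\operatorname{add}$ = closure under isomorphisms, finite direct sums and direct summands), $\mathrm{SUB}(R)$ is the direct sum of all indecomposables in $\mathrm{sub}(R)$ up to isomorphism, and $E_R:=\operatorname{End}_R(\mathrm{SUB}(R))$. If $R$ has finite representation type, $\mathrm{AUS}$ is the direct sum of all indecomposable $R$-modules up to isomorphism, and the Auslander algebra is $E_R^{\mathrm{AUS}}:=\operatorname{End}_R(\mathrm{AUS})$. *)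

(* Defs.v *)
From HB Require Import structures.
From mathcomp Require Import all_boot all_order all_algebra all_field.
From mathcomp Require Import finmap boolp.
From mathcomp.multinomials Require Import monalg.

Set Implicit Arguments.
Unset Strict Implicit.
Unset Printing Implicit Defensive.

Import GRing.Theory.

Local Open Scope ring_scope.

Record quiver := Quiver {
  vertex : finType;
  arrow : finType;
  source : arrow -> vertex;
  target : arrow -> vertex
}.

Section Paths.
Variable Q : quiver.

(* The arrows of a path are listed in the order in which they are traversed. *)
Fixpoint is_walk (v : vertex Q) (s : seq (arrow Q)) : bool :=
  if s is a :: s' then (source a == v) && is_walk (target a) s' else true.

Definition walk_end (v : vertex Q) (s : seq (arrow Q)) : vertex Q :=
  last v [seq target a | a <- s].

(* The starting vertex is part of the data, which provides one lazy path     *)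
(* (v, [::]) for each vertex v.                                              *)
Record qpath := QPath {
  qdata : vertex Q * seq (arrow Q);
  qdata_walk : is_walk qdata.1 qdata.2
}.
HB.instance Definition _ := [isSub for qdata].
HB.instance Definition _ := [Choice of qpath by <:].

Definition qstart (p : qpath) : vertex Q := (qdata p).1.
Definition qarrows (p : qpath) : seq (arrow Q) := (qdata p).2.
Definition qend (p : qpath) : vertex Q := walk_end (qstart p) (qarrows p).

Definition lazy (v : vertex Q) : qpath := @QPath (v, [::]) isT.

(* The product pq is q followed by p; None stands for the zero product. *)
Definition qcomp (p q : qpath) : option qpath :=
  if qstart p == qend q
  then insub (qstart q, qarrows q ++ qarrows p) : option qpath else None.

Lemma is_walk_cat v s t :
  is_walk v (s ++ t) = is_walk v s && is_walk (walk_end v s) t.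
Proof. by elim: s v => //= a s IHs v; rewrite IHs andbA. Qed.

Lemma walk_end_cat v s t :
  walk_end v (s ++ t) = walk_end (walk_end v s) t.
Proof. by rewrite /walk_end map_cat last_cat. Qed.

Lemma qcompP p q : qstart p = qend q ->
  exists r, [/\ qcomp p q = Some r, qstart r = qstart q,
                qarrows r = qarrows q ++ qarrows p & qend r = qend p].
Proof.
move=> pq; rewrite /qcomp pq eqxx.
have w : is_walk (qstart q, qarrows q ++ qarrows p).1
                 (qstart q, qarrows q ++ qarrows p).2.
  rewrite /= is_walk_cat (qdata_walk q) /= -/(qend q) -pq.
  exact: (qdata_walk p).
exists (QPath w); rewrite insubT; split => //.
by rewrite /qend /qstart /qarrows /= walk_end_cat -/(qend q) -pq.
Qed.

Lemma qcompN p q : qstart p != qend q -> qcomp p q = None.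
Proof. by rewrite /qcomp => /negPf->. Qed.

Lemma qpath_eq p q : qstart p = qstart q -> qarrows p = qarrows q -> p = q.
Proof.
case: p q => [[v s] ?] [[w t] ?]; rewrite /qstart /qarrows /= => vw st.
by apply: val_inj; rewrite /= vw st.
Qed.

Lemma qcompA p q r :
  obind (fun s => qcomp p s) (qcomp q r) = obind (fun s => qcomp s r) (qcomp p q).
Proof.
have [pq|pq] := eqVneq (qstart p) (qend q);
  have [qr|qr] := eqVneq (qstart q) (qend r).
- have [s [-> s1 s2 s3]] := qcompP pq; have [t [-> t1 t2 t3]] := qcompP qr => /=.
  have [|u [-> u1 u2 _]] /= := @qcompP p t; first by rewrite t3.
  have [|w [-> w1 w2 _]] := @qcompP s r; first by rewrite s1.
  congr Some; apply: qpath_eq; first by rewrite u1 t1 w1.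
  by rewrite u2 t2 w2 s2 catA.
- rewrite (qcompN qr) /=; have [s [-> s1 _ _]] /= := qcompP pq.
  by rewrite qcompN ?s1.
- rewrite (qcompN pq) /=; have [t [-> _ _ t3]] /= := qcompP qr.
  by rewrite qcompN ?t3.
- by rewrite (qcompN pq) (qcompN qr).
Qed.

Lemma qcomp_lazyl v p :
  qcomp (lazy v) p = if v == qend p then Some p else None.
Proof.
have [vp|vp] := eqVneq v (qend p); last exact: qcompN.
have [r [-> r1 r2 _]] := @qcompP (lazy v) p vp.
by congr Some; apply: qpath_eq; rewrite // r2 cats0.
Qed.

Lemma qcomp_lazyr v p :
  qcomp p (lazy v) = if qstart p == v then Some p else None.
Proof.
have [vp|vp] := eqVneq (qstart p) v; last exact: qcompN.
have [r [-> r1 r2 _]] := @qcompP p (lazy v) vp.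
by congr Some; apply: qpath_eq; rewrite ?r1 ?r2.
Qed.

End Paths.

(* kQ is the vector space with basis the paths of Q.  It is the zero ring if *)
(* Q has no vertex, hence is only a pzRingType and an lmodType k.            *)
Definition pathalg (k : fieldType) (Q : quiver) : Type := {malg k[qpath Q]}.
HB.instance Definition _ (k : fieldType) (Q : quiver) :=
  GRing.Lmodule.on (pathalg k Q).

Section PathAlgebra.
Variables (k : fieldType) (Q : quiver).
Local Notation kQ := (pathalg k Q).

Definition of_path (p : qpath Q) : kQ := << 1 *g p >>.

Definition path_extend (V : lmodType k) (h : qpath Q -> V) (x : kQ) : V :=
  \sum_(p <- msupp x) (mcoeff p x) *: h p.

Definition path_mul (p q : qpath Q) : kQ := oapp of_path 0 (qcomp p q).

Definition pathalg_mul (x y : kQ) : kQ :=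
  path_extend (fun p => path_extend (fun q => path_mul p q) y) x.

Definition pathalg_one : kQ := \sum_(v : vertex Q) of_path (lazy v).

Section Extend.
Variables (V : lmodType k) (h : qpath Q -> V).

Lemma path_extendEw (x : kQ) (d : {fset qpath Q}) : (msupp x `<=` d)%fset ->
  path_extend h x = \sum_(p <- d) (mcoeff p x) *: h p.
Proof.
move=> xd; rewrite /path_extend (big_fset_incl _ xd) //= => p _ px.
by rewrite mcoeff_outdom ?scale0r.
Qed.

Lemma path_extend_linear : linear (path_extend h).
Proof.
move=> a x y; pose d := (msupp x `|` msupp y `|` msupp (a *: x + y))%fset.
rewrite !(@path_extendEw _ d) /d.
- rewrite scaler_sumr -big_split /=; apply: eq_bigr => p _.
  by rewrite mcoeffD mcoeffZ scalerDl scalerA.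
- by rewrite fsetUAC fsubsetUr.
- by rewrite -fsetUA fsubsetUl.
- by rewrite fsubsetUr.
Qed.

HB.instance Definition _ :=
  GRing.isLinear.Build k kQ V *:%R (path_extend h) path_extend_linear.

Lemma path_extendU p : path_extend h (of_path p) = h p.
Proof.
rewrite (@path_extendEw _ [fset p]%fset) ?msuppU_le //.
by rewrite big_seq_fset1 mcoeffUU scale1r.
Qed.

End Extend.

Lemma path_extend_eq (V : lmodType k) (h1 h2 : qpath Q -> V) :
  h1 =1 h2 -> path_extend h1 =1 path_extend h2.
Proof. by move=> h12 x; apply: eq_bigr => p _; rewrite h12. Qed.

Lemma pathalgE (x : kQ) :
  x = \sum_(p <- msupp x) (mcoeff p x) *: of_path p.
Proof.
rewrite {1}[x]monalgE; apply: eq_bigr => p _; apply/malgP => q.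
by rewrite mcoeffZ !mcoeffU mulr_natr.
Qed.

Lemma path_extend_id (x : kQ) : path_extend of_path x = x.
Proof. by rewrite [RHS]pathalgE. Qed.

Lemma pathalg_ext (V : lmodType k) (f g : {linear kQ -> V}) :
  (forall p, f (of_path p) = g (of_path p)) -> f =1 g.
Proof.
move=> fg x; rewrite (pathalgE x) !linear_sum; apply: eq_bigr => p _.
by rewrite !linearZ /= fg.
Qed.

Lemma pathalg_mul_linearr x : linear (pathalg_mul x).
Proof.
move=> a y z; rewrite /pathalg_mul /path_extend scaler_sumr -big_split /=.
apply: eq_bigr => p _; rewrite -!/(path_extend _ _) linearP scalerDr.
by rewrite !scalerA mulrC.
Qed.
HB.instance Definition _ x :=
  GRing.isLinear.Build k kQ kQ *:%R (pathalg_mul x) (pathalg_mul_linearr x).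

Definition pathalg_mulr (y x : kQ) := pathalg_mul x y.

Lemma pathalg_mul_linearl y : linear (pathalg_mulr y).
Proof. by move=> a x z; rewrite /pathalg_mulr /pathalg_mul linearP. Qed.
HB.instance Definition _ y :=
  GRing.isLinear.Build k kQ kQ *:%R (pathalg_mulr y) (pathalg_mul_linearl y).

Lemma pathalg_mulUU p q : pathalg_mul (of_path p) (of_path q) = path_mul p q.
Proof. by rewrite /pathalg_mul !path_extendU. Qed.

Lemma pathalg_mulA : associative pathalg_mul.
Proof.
move=> x y z.
pose f1 : kQ -> kQ := pathalg_mulr (pathalg_mul y z).
pose g1 : kQ -> kQ := pathalg_mulr z \o pathalg_mulr y.
suff /(_ x) : f1 =1 g1 by [].
apply: (@pathalg_ext _ f1 g1) => p; rewrite /f1 /g1 /= {x f1 g1} /pathalg_mulr.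
pose f2 : kQ -> kQ := pathalg_mul (of_path p) \o pathalg_mulr z.
pose g2 : kQ -> kQ := pathalg_mulr z \o pathalg_mul (of_path p).
suff /(_ y) : f2 =1 g2 by [].
apply: (@pathalg_ext _ f2 g2) => q; rewrite /f2 /g2 /= {y f2 g2} /pathalg_mulr.
pose f3 : kQ -> kQ := pathalg_mul (of_path p) \o pathalg_mul (of_path q).
pose g3 : kQ -> kQ := pathalg_mul (pathalg_mul (of_path p) (of_path q)).
suff /(_ z) : f3 =1 g3 by [].
apply: (@pathalg_ext _ f3 g3) => r; rewrite /f3 /g3 /= {z f3 g3}.
rewrite !pathalg_mulUU /path_mul; have := qcompA p q r.
have m0 (s : kQ) : pathalg_mul s 0 = 0 by rewrite linear0.
have m0' (s : kQ) : pathalg_mul 0 s = 0 by apply: (linear0 (pathalg_mulr s)).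
by case: (qcomp q r) (qcomp p q) => [s|] [t|] /=;
   rewrite ?pathalg_mulUU ?m0 ?m0' /path_mul //; [move-> | move-> | move<-].
Qed.

Lemma pathalg_mul1 : left_id pathalg_one pathalg_mul.
Proof.
apply: (@pathalg_ext _ (pathalg_mul pathalg_one) idfun) => p /=.
rewrite -[LHS]/(pathalg_mulr (of_path p) pathalg_one) linear_sum /=.
rewrite (bigD1 (qend p)) //= big1 => [|v /negPf vp].
  by rewrite addr0 /pathalg_mulr pathalg_mulUU /path_mul qcomp_lazyl eqxx.
by rewrite /pathalg_mulr pathalg_mulUU /path_mul qcomp_lazyl vp.
Qed.

Lemma pathalg_1mul : right_id pathalg_one pathalg_mul.
Proof.
apply: (@pathalg_ext _ (pathalg_mulr pathalg_one) idfun) => p /=.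
rewrite /pathalg_mulr linear_sum /= (bigD1 (qstart p)) //= big1 => [|v vp].
  by rewrite addr0 pathalg_mulUU /path_mul qcomp_lazyr eqxx.
by rewrite pathalg_mulUU /path_mul qcomp_lazyr eq_sym (negPf vp).
Qed.

Lemma pathalg_mulDl : left_distributive pathalg_mul +%R.
Proof. by move=> x y z; apply: (linearD (pathalg_mulr z)). Qed.

Lemma pathalg_mulDr : right_distributive pathalg_mul +%R.
Proof. by move=> x y z; rewrite linearD. Qed.

HB.instance Definition _ := GRing.Zmodule_isPzRing.Build kQ
  pathalg_mulA pathalg_mul1 pathalg_1mul pathalg_mulDl pathalg_mulDr.

Definition two_sided_ideal (I : kQ -> Prop) : Prop :=
  [/\ I 0,
      forall x y, I x -> I y -> I (x + y)
    & forall a x b, I x -> I (a * x * b)].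

Definition path_ideal (S : qpath Q -> Prop) (x : kQ) : Prop :=
  forall I, two_sided_ideal I -> (forall p, S p -> I (of_path p)) -> I x.

(* pi exhibits R as the quotient of kQ by the ideal generated by the set of  *)
(* paths S                                                                   *)
Definition monomial_presentation (S : qpath Q -> Prop) (R : falgType k)
    (pi : {rmorphism kQ -> R}) : Prop :=
  [/\ scalable pi,
      forall r : R, exists x, pi x = r
    & forall x, pi x = 0 <-> path_ideal S x].

Definition monomial (R : falgType k) (pi : {rmorphism kQ -> R}) (m : R) : Prop :=
  exists p, m = pi (of_path p).

End PathAlgebra.

Definition surjective (A B : Type) (f : A -> B) : Prop :=
  forall b, exists a, f a = b.

Section DirectSum.
Variables (R : pzRingType) (n : nat) (M : 'I_n -> lmodType R).

Definition dsum : Type := {dffun forall i : 'I_n, M i}.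
HB.instance Definition _ := Choice.on dsum.

Implicit Types x y : dsum.

Definition dsum_zero : dsum := [ffun i => 0].
Definition dsum_opp x : dsum := [ffun i => - x i].
Definition dsum_add x y : dsum := [ffun i => x i + y i].
Definition dsum_scale (a : R) x : dsum := [ffun i => a *: x i].

Lemma dsum_addA : associative dsum_add.
Proof. by move=> x y z; apply/ffunP => i; rewrite !ffunE addrA. Qed.
Lemma dsum_addC : commutative dsum_add.
Proof. by move=> x y; apply/ffunP => i; rewrite !ffunE addrC. Qed.
Lemma dsum_add0 : left_id dsum_zero dsum_add.
Proof. by move=> x; apply/ffunP => i; rewrite !ffunE add0r. Qed.
Lemma dsum_addN : left_inverse dsum_zero dsum_opp dsum_add.
Proof. by move=> x; apply/ffunP => i; rewrite !ffunE addNr. Qed.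
HB.instance Definition _ :=
  GRing.isZmodule.Build dsum dsum_addA dsum_addC dsum_add0 dsum_addN.

Lemma dsum_scaleA a b x : dsum_scale a (dsum_scale b x) = dsum_scale (a * b) x.
Proof. by apply/ffunP => i; rewrite !ffunE scalerA. Qed.
Lemma dsum_scale1 : left_id 1 dsum_scale.
Proof. by move=> x; apply/ffunP => i; rewrite !ffunE scale1r. Qed.
Lemma dsum_scaleDr : right_distributive dsum_scale +%R.
Proof. by move=> a x y; apply/ffunP => i; rewrite !ffunE scalerDr. Qed.
Lemma dsum_scaleDl x : {morph dsum_scale^~ x : a b / a + b}.
Proof. by move=> a b; apply/ffunP => i; rewrite !ffunE scalerDl. Qed.
HB.instance Definition _ := GRing.Zmodule_isLmodule.Build R dsum
  dsum_scaleA dsum_scale1 dsum_scaleDr dsum_scaleDl.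

End DirectSum.

Section Modules.
Variable R : pzRingType.

Definition lmod_iso (M N : lmodType R) : Prop :=
  exists f : {linear M -> N}, bijective f.

Definition finitely_generated (M : lmodType R) : Prop :=
  exists n (g : 'I_n -> M), forall x, exists c : 'I_n -> R,
    x = \sum_i c i *: g i.

Definition zero_module (M : lmodType R) : Prop := forall x : M, x = 0.

Definition indecomposable (M : lmodType R) : Prop :=
  ~ zero_module M /\
  forall A B : lmodType R, lmod_iso M (A * B)%type ->
    zero_module A \/ zero_module B.

(* injectivity in the category of finitely generated modules *)
Definition injective_module (E : lmodType R) : Prop :=
  forall (A B : lmodType R) (i : {linear A -> B}) (f : {linear A -> E}),
    finitely_generated A -> finitely_generated B -> injective i ->
    exists g : {linear B -> E}, forall a, g (i a) = f a.

Definition self_injective : Prop := injective_module R^o.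

Definition embeds_in_free (U : lmodType R) : Prop :=
  exists n (f : {linear U -> 'rV[R]_n}), injective f.

Definition add_closure (P : lmodType R -> Prop) (M : lmodType R) : Prop :=
  exists n (U : 'I_n -> lmodType R), (forall i, P (U i)) /\
    exists N : lmodType R, lmod_iso (M * N)%type (dsum U).

Definition in_sub : lmodType R -> Prop := add_closure embeds_in_free.

(* X is the direct sum of all indecomposables in the class P, one for each   *)
(* isomorphism class; such an X exists only if these classes are finitely    *)
(* many.                                                                     *)
Definition sum_of_indecomposables (P : lmodType R -> Prop) (X : lmodType R) :
    Prop :=
  exists n (M : 'I_n -> lmodType R),
    [/\ forall i, P (M i) /\ indecomposable (M i),
        forall i j, lmod_iso (M i) (M j) -> i = j,
        forall U, P U -> indecomposable U -> exists i, lmod_iso U (M i)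
      & lmod_iso X (dsum M)].

Definition is_SUB : lmodType R -> Prop := sum_of_indecomposables in_sub.
Definition is_AUS : lmodType R -> Prop := sum_of_indecomposables finitely_generated.

Definition finite_representation_type : Prop :=
  exists n (M : 'I_n -> lmodType R), forall U,
    finitely_generated U -> indecomposable U -> exists i, lmod_iso U (M i).

Definition primitive_idempotent (e : R) : Prop :=
  [/\ e * e = e, e <> 0
    & forall e1 e2, e1 * e1 = e1 -> e2 * e2 = e2 ->
        e1 * e2 = 0 -> e2 * e1 = 0 -> e = e1 + e2 -> e1 = 0 \/ e2 = 0].

End Modules.

Section PrincipalLeftIdeal.
Variables (R : pzRingType) (m : R).

Definition in_Rm : {pred R^o} := fun x => `[< exists r : R, x = r * m >].

Lemma in_Rm_submod : submod_closed in_Rm.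
Proof.
split=> [|a x y]; first by apply/asboolP; exists 0; rewrite mul0r.
move=> /asboolP[r ->] /asboolP[s ->]; apply/asboolP.
by exists (a * r + s); rewrite mulrDl -mulrA.
Qed.
HB.instance Definition _ := GRing.isSubmodClosed.Build R R^o in_Rm in_Rm_submod.

Record Rm := RmElt { Rm_val : R^o; Rm_valP : Rm_val \in in_Rm }.
HB.instance Definition _ := [isSub for Rm_val].
HB.instance Definition _ := [Choice of Rm by <:].
HB.instance Definition _ := [SubChoice_isSubLmodule of Rm by <:].

End PrincipalLeftIdeal.

Definition epi_exists (R : pzRingType) (M N : lmodType R) : Prop :=
  exists f : {linear M -> N}, surjective f.

Definition ideally_ordered (k : fieldType) (Q : quiver) (R : falgType k)
    (pi : {rmorphism pathalg k Q -> R}) : Prop :=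
  forall e : R, primitive_idempotent e ->
  forall m n : R, monomial pi m -> monomial pi n ->
    (exists r, m = e * r) -> (exists r, n = e * r) ->
    epi_exists (Rm m) (Rm n) \/ epi_exists (Rm n) (Rm m).

(* End_R(M) is the zero ring if M = 0, hence is only a pzRingType and an     *)
(* lmodType k.                                                               *)
Definition endo (k : fieldType) (R : falgType k) (M : lmodType R) : Type :=
  {linear M -> M}.

Section Endo.
Variables (k : fieldType) (R : falgType k) (M : lmodType R).
Local Notation E := (endo M).
HB.instance Definition _ := gen_eqMixin E.
HB.instance Definition _ := gen_choiceMixin E.

Lemma endoP (f g : E) : (f : M -> M) =1 g -> f = g.
Proof.
case: f g => [f [[fD] [fZ]]] [g [[gD] [gZ]]] /= /funext fg.
by subst g; rewrite (Prop_irrelevance fD gD) (Prop_irrelevance fZ gZ).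
Qed.

Definition endo_zero : E := \0 : M -> M.
Definition endo_opp (f : E) : E := \- f : M -> M.
Definition endo_add (f g : E) : E := f \+ g : M -> M.
Definition endo_one : E := idfun : M -> M.
Definition endo_mul (f g : E) : E := f \o g : M -> M.

(* k acts on M through its image in the centre of R, so that this map is     *)
(* again R-linear.                                                           *)
Definition endo_scale_fun (c : k) (f : E) (x : M) : M := (c%:A : R) *: f x.
Lemma endo_scale_linear c f : linear (endo_scale_fun c f).
Proof.
move=> a x y; rewrite /endo_scale_fun linearP scalerDr !scalerA.
by rewrite mulr_algl mulr_algr.
Qed.
HB.instance Definition _ c f := GRing.isLinear.Build R M M *:%R
  (endo_scale_fun c f) (endo_scale_linear c f).
Definition endo_scale (c : k) (f : E) : E := endo_scale_fun c f : M -> M.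

Lemma endo_addA : associative endo_add.
Proof. by move=> f g h; apply: endoP => x /=; rewrite addrA. Qed.
Lemma endo_addC : commutative endo_add.
Proof. by move=> f g; apply: endoP => x /=; rewrite addrC. Qed.
Lemma endo_add0 : left_id endo_zero endo_add.
Proof. by move=> f; apply: endoP => x /=; rewrite add0r. Qed.
Lemma endo_addN : left_inverse endo_zero endo_opp endo_add.
Proof. by move=> f; apply: endoP => x /=; rewrite addNr. Qed.
HB.instance Definition _ :=
  GRing.isZmodule.Build E endo_addA endo_addC endo_add0 endo_addN.

Lemma endo_mulA : associative endo_mul.
Proof. by move=> f g h; apply: endoP. Qed.
Lemma endo_mul1 : left_id endo_one endo_mul.
Proof. by move=> f; apply: endoP. Qed.
Lemma endo_1mul : right_id endo_one endo_mul.
Proof. by move=> f; apply: endoP. Qed.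
Lemma endo_mulDl : left_distributive endo_mul +%R.
Proof. by move=> f g h; apply: endoP. Qed.
Lemma endo_mulDr : right_distributive endo_mul +%R.
Proof. by move=> f g h; apply: endoP => x /=; rewrite linearD. Qed.
HB.instance Definition _ := GRing.Zmodule_isPzRing.Build E
  endo_mulA endo_mul1 endo_1mul endo_mulDl endo_mulDr.

Lemma endo_scaleA a b f : endo_scale a (endo_scale b f) = endo_scale (a * b) f.
Proof.
apply: endoP => x /=; rewrite /endo_scale_fun /= /endo_scale_fun scalerA.
by rewrite mulr_algl scalerA.
Qed.
Lemma endo_scale1 : left_id 1 endo_scale.
Proof.
by move=> f; apply: endoP => x /=; rewrite /endo_scale_fun scale1r scale1r.
Qed.
Lemma endo_scaleDr : right_distributive endo_scale +%R.
Proof.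
by move=> a f g; apply: endoP => x /=; rewrite /endo_scale_fun scalerDr.
Qed.
Lemma endo_scaleDl f : {morph endo_scale^~ f : a b / a + b}.
Proof.
by move=> a b; apply: endoP => x /=; rewrite /endo_scale_fun !scalerDl.
Qed.
HB.instance Definition _ := GRing.Zmodule_isLmodule.Build k E
  endo_scaleA endo_scale1 endo_scaleDr endo_scaleDl.

End Endo.

Definition endo_alg_iso (k : fieldType) (R : falgType k) (M N : lmodType R) :
    Prop :=
  exists f : {rmorphism endo M -> endo N}, scalable f /\ bijective f.

(* Main.v *)
(* Suppose that End(AUS) and End(SUB) are isomorphic.  As SUB is a summand of *)
(* AUS, comparing dimensions shows that SUB = AUS, so that every              *)
(* indecomposable module is torsionless.  Let a <> b be nonzero arrows from   *)
(* v.  As R e_v / R b and R e_v / R a are torsionless, there are paths p, p'  *)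
(* with a p <> 0 = b p and b p' <> 0 = a p', and then there is no epimorphism *)
(* between R p and R p', against the ordering hypothesis.  So a path is       *)
(* determined by its start and length, and there is exactly one maximal       *)
(* nonzero path from each vertex.  As the simple modules are torsionless,     *)
(* such a path ends at every vertex, hence exactly one does, and the sum of   *)
(* the coefficients of the maximal paths is a linear form whose kernel        *)
(* contains no nonzero left ideal; hence R is self-injective.                 *)
(*   Conversely, if R is self-injective, extending maps between left ideals   *)
(* shows again that at most one nonzero arrow leaves each vertex and that     *)
(* exactly one maximal path ends at each vertex.  From this every             *)
(* indecomposable module is isomorphic to R z for a nonzero path z, so there  *)
(* are finitely many of them and they all lie in sub(R).                      *)

From HB Require Import structures.
Require Import Defs.
From mathcomp Require Import all_boot all_order all_algebra all_field.
From mathcomp Require Import finmap boolp.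
From mathcomp.multinomials Require Import monalg.

Set Implicit Arguments.
Unset Strict Implicit.
Unset Printing Implicit Defensive.

Import GRing.Theory.

Local Open Scope ring_scope.

(** * Paths *)

(** The nonzero paths form a [k]-basis of [R] ([coefE]), and both directions pass through two
    conditions on them: [unique_out], which makes every R e_v uniserial, and [unique_socle], which
    makes the left socle of [R] multiplicity free. If End(AUS) and End(SUB) are isomorphic, then SUB
    is a retract of AUS and, by finite dimension, the retract is everything
    ([endo_alg_iso_retract]), so every finitely generated indecomposable is torsionless
    ([indecomposables_in_sub]). Torsionlessness of R e_v / R b together with the ordering gives
    [ordered_unique_out]; torsionlessness of the simple modules and a count of vertices give
    [unique_out_unique_socle]. Then no nonzero left ideal lies in the kernel of [socle_form], so [R]
    is a Frobenius algebra, hence self-injective ([nondegenerate_form_self_injective]). Conversely,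
    extending maps defined on left ideals of a self-injective [R] yields [self_injective_unique_out]
    and [self_injective_unique_socle]. These force every finitely generated indecomposable to be R z
    for a nonzero path z ([self_injective_indecomposable]). Such modules are finitely many and embed
    in [R], so one module is both AUS and SUB. *)

Section PathCombinatorics.
Variable Q : quiver.
Implicit Types p q r s t : qpath Q.

Definition qlen p := size (qarrows p).

Lemma qcomp_SomeP p q r : qcomp p q = Some r ->
  [/\ qstart p = qend q, qstart r = qstart q,
      qarrows r = qarrows q ++ qarrows p & qend r = qend p].
Proof.
have [pq|pq] := eqVneq (qstart p) (qend q); last by rewrite qcompN.
by have [s [-> ? ? ?]] := qcompP pq; case=> <-.
Qed.

Lemma qcomp_len p q r : qcomp p q = Some r -> qlen r = (qlen q + qlen p)%N.
Proof. by case/qcomp_SomeP=> _ _ e _; rewrite /qlen e size_cat. Qed.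

Lemma qcomp_injr p q q' r : qcomp p q = Some r -> qcomp p q' = Some r -> q = q'.
Proof.
case/qcomp_SomeP=> _ s1 e1 _ /qcomp_SomeP[_ s2 e2 _]; apply: qpath_eq.
  by rewrite -s1.
have /eqP : (size (qarrows q) + size (qarrows p) = size (qarrows q') + size (qarrows p))%N.
  by rewrite -!size_cat -e1 e2.
rewrite eqn_add2r => /eqP sz; have /eqP := e1.
by rewrite e2 eqseq_cat ?sz // eqxx andbT => /eqP.
Qed.

Lemma qcomp_injl p p' q r : qcomp p q = Some r -> qcomp p' q = Some r -> p = p'.
Proof.
case/qcomp_SomeP=> s1 _ e1 _ /qcomp_SomeP[s2 _ e2 _]; apply: qpath_eq.
  by rewrite s1 s2.
by have /eqP := e1; rewrite e2 eqseq_cat // eqxx => /eqP.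
Qed.

Lemma qlen0_lazy p : qlen p = 0%N -> p = lazy (qstart p).
Proof. by move/size0nil=> p0; apply: qpath_eq. Qed.

Lemma lazy_eq (v w : vertex Q) : (lazy v == lazy w) = (v == w).
Proof.
by apply/eqP/eqP => [/(congr1 (@qstart Q))|->].
Qed.

Lemma qcomp_lenr p q r : qcomp p q = Some r -> qlen r = qlen q -> r = q.
Proof.
move=> c; have [_ e1 e2 _] := qcomp_SomeP c.
rewrite (qcomp_len c) -{2}[qlen q]addn0 => /addnI/size0nil p0.
by apply: qpath_eq => //; rewrite e2 p0 cats0.
Qed.

Lemma qcomp_lenl p q r : qcomp p q = Some r -> qlen r = qlen p -> r = p.
Proof.
move=> c; have [e0 e1 e2 _] := qcomp_SomeP c.
rewrite (qcomp_len c) -{2}[qlen p]add0n => /addIn q0; apply: qpath_eq.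
  by rewrite e1 e0 (qlen0_lazy q0).
by rewrite e2 (size0nil q0).
Qed.

Lemma qcomp_prefix p q (s : seq (arrow Q)) :
  qstart q = qstart p -> qarrows q = qarrows p ++ s ->
  exists2 t, qcomp t p = Some q & qarrows t = s.
Proof.
move=> e1 e2; have w : is_walk (qend p) s.
  have := qdata_walk q; rewrite -/(qarrows q) -/(qstart q) e2 is_walk_cat e1.
  by case/andP.
exists (@QPath Q (qend p, s) w) => //.
have [//|r [-> r1 r2 _]] := @qcompP Q (@QPath Q (qend p, s) w) p.
by congr Some; apply: qpath_eq; rewrite ?r1 ?r2 ?e1 ?e2.
Qed.

Lemma arr_walk (a : arrow Q) : is_walk (source a) [:: a].
Proof. by rewrite /= eqxx. Qed.
Definition arr (a : arrow Q) : qpath Q := QPath (arr_walk a : is_walk (_, _).1 (_, _).2).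

Lemma qarrow_factor p a : a \in qarrows p ->
  exists s t u, qcomp (arr a) s = Some t /\ qcomp u t = Some p.
Proof.
case: p => [[v l] w] /=; rewrite /qarrows /= => al.
case/splitPr: al w => l1 l2; rewrite /= => w.
have := w; rewrite is_walk_cat /= => /and3P[w1 /eqP sa w2].
pose s := @QPath Q (v, l1) w1.
have w3 : is_walk (v, rcons l1 a).1 (v, rcons l1 a).2.
  by rewrite /= -cats1 is_walk_cat w1 /= sa eqxx.
have [||u cu _] // := @qcomp_prefix (QPath w3) (@QPath Q (v, l1 ++ a :: l2) w) l2.
  by rewrite /qarrows /= cat_rcons.
have [||a' ca ea] // := @qcomp_prefix s (QPath w3) [:: a].
  by rewrite /qarrows /= cats1.
exists s, (QPath w3), u; split=> //; rewrite -ca; congr (qcomp _ _).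
apply: qpath_eq => //; have [-> _ _ _] := qcomp_SomeP ca.
exact: sa.
Qed.

End PathCombinatorics.

(** * The basis of nonzero paths *)

Section MonomialAlgebra.
Variables (k : fieldType) (Q : quiver) (S : qpath Q -> Prop) (R : falgType k).
Variable pi : {rmorphism pathalg k Q -> R}.
Hypothesis presR : monomial_presentation S pi.
Local Notation kQ := (pathalg k Q).
Implicit Types p q s t u : qpath Q.

Definition mon p : R := pi (of_path k p).
Definition nz p := mon p != 0.

Lemma path_mulE p q : of_path k p * of_path k q = path_mul k p q :> kQ.
Proof. exact: pathalg_mulUU. Qed.

Lemma mon_mul p q : mon p * mon q = oapp mon 0 (qcomp p q).
Proof.
rewrite /mon -rmorphM path_mulE /path_mul.
by case: (qcomp p q) => //=; rewrite rmorph0.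
Qed.

Lemma mon_qcomp p q r : qcomp p q = Some r -> mon r = mon p * mon q.
Proof. by rewrite mon_mul => ->. Qed.

Lemma nz_qcomp p q r : qcomp p q = Some r -> nz r -> nz p /\ nz q.
Proof.
move/mon_qcomp=> e; rewrite /nz e; split.
  by apply: contraNneq H => ->; rewrite mul0r.
by apply: contraNneq H => ->; rewrite mulr0.
Qed.

Lemma mon1 : \sum_v mon (lazy v) = 1.
Proof. by rewrite -[RHS](rmorph1 pi) -raddf_sum. Qed.

Lemma mcoeff_of_path p q : mcoeff p (of_path k q : kQ) = (q == p)%:R.
Proof. exact: mcoeffU. Qed.

Definition termwise_in_ideal (x : kQ) :=
  forall p, mcoeff p x != 0 -> path_ideal S (of_path k p).
Local Notation J := termwise_in_ideal.

Lemma termwise_in_ideal0 : J 0.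
Proof. by move=> p; rewrite mcoeff0 eqxx. Qed.

Lemma termwise_in_idealD x y : J x -> J y -> J (x + y).
Proof.
move=> Jx Jy p; rewrite mcoeffD; have [->|/Jx//] := eqVneq (mcoeff p x) 0.
by rewrite add0r => /Jy.
Qed.

Lemma termwise_in_idealU p : path_ideal S (of_path k p) -> J (of_path k p).
Proof.
move=> Sp q; rewrite mcoeff_of_path.
have [<- _|_] := eqVneq p q; first exact: Sp.
by case/eqP.
Qed.

Lemma termwise_in_ideal_extend (h : qpath Q -> kQ) x :
  (forall p, mcoeff p x != 0 -> J (h p)) -> J (path_extend h x).
Proof.
move=> Jh; rewrite /path_extend big_seq_cond; apply: (@big_ind _ J).
- exact: termwise_in_ideal0.
- exact: termwise_in_idealD.
- move=> p /andP[px _] q; rewrite mcoeffZ mulf_eq0 negb_or => /andP[_].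
  by apply: Jh; rewrite mcoeff_neq0.
Qed.

Lemma path_ideal_mull (a x : kQ) : path_ideal S x -> path_ideal S (a * x).
Proof.
move=> h I II SI; have [_ _ Im] := II.
by have := Im a _ 1 (h I II SI); rewrite mulr1.
Qed.

Lemma path_ideal_mulr (a x : kQ) : path_ideal S x -> path_ideal S (x * a).
Proof.
move=> h I II SI; have [_ _ Im] := II.
by have := Im 1 _ a (h I II SI); rewrite mul1r.
Qed.

Lemma termwise_in_ideal_path_mul p q :
  path_ideal S (of_path k p) \/ path_ideal S (of_path k q) -> J (path_mul k p q).
Proof.
move=> Spq; have : path_ideal S (of_path k p * of_path k q : kQ).
  by case: Spq => [/path_ideal_mulr|/path_ideal_mull]; apply.
rewrite path_mulE /path_mul; case: (qcomp p q) => [r|] /= Sr.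
  exact: termwise_in_idealU.
exact: termwise_in_ideal0.
Qed.

(** The elements all of whose supporting paths lie in the ideal form a two-sided ideal containing
    the generators, so they include the whole of [path_ideal S]. This is where monomiality
    enters. *)
Lemma path_ideal_supp (x : kQ) p : path_ideal S x -> mcoeff p x != 0 ->
  path_ideal S (of_path k p).
Proof.
move=> Sx; move: p; rewrite -/(J x); apply: Sx => {x}; last first.
  by move=> p Sp; apply: termwise_in_idealU => I _; apply.
split; [exact: termwise_in_ideal0 | exact: termwise_in_idealD |].
move=> a x b Jx.
have Jax : J (a * x).
  apply: termwise_in_ideal_extend => p _; apply: termwise_in_ideal_extend => q qx.
  by apply: termwise_in_ideal_path_mul; right; apply: Jx.
apply: termwise_in_ideal_extend => p px; apply: termwise_in_ideal_extend => q _.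
by apply: termwise_in_ideal_path_mul; left; apply: Jax.
Qed.

Lemma pi_scale c (x : kQ) : pi (c *: x) = c *: pi x.
Proof. by have [sc _ _] := presR; apply: sc. Qed.

Lemma pi_surj (r : R) : exists x : kQ, pi x = r.
Proof. by have [_ h _] := presR. Qed.

Lemma pi_eq (x y : kQ) p : nz p -> pi x = pi y -> mcoeff p x = mcoeff p y.
Proof.
move=> nzp /eqP; rewrite -subr_eq0 -rmorphB => /eqP exy.
have [_ _ /(_ (x - y)) [/(_ exy) h _]] := presR.
have [/eqP|xyp] := boolP (mcoeff p (x - y) == 0).
  by rewrite mcoeffB => /eqP; rewrite subr_eq0 => /eqP.
have [_ _ /(_ (of_path k p)) [_]] := presR.
by move=> /(_ (path_ideal_supp h xyp)) /eqP; rewrite -/(mon p) (negPf nzp).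
Qed.

(** Read off a chosen preimage in [kQ]; by [pi_eq] the choice does not matter when [p] is nonzero.
    The value 0 for vanishing paths keeps [coef p] linear for every [p]. *)
Definition coef p (r : R) : k^o :=
  if nz p then mcoeff p (sval (cid (pi_surj r))) else 0.

Lemma coef_pi p x : nz p -> coef p (pi x) = mcoeff p x.
Proof. by move=> h; rewrite /coef h; apply: pi_eq => //; case: cid. Qed.

Lemma coef_linear p : linear (coef p).
Proof.
move=> c x y; have [h|h] := boolP (nz p); last first.
  by rewrite /coef (negPf h) scaler0 addr0.
have [x' <-] := pi_surj x; have [y' <-] := pi_surj y.
by rewrite -pi_scale -rmorphD !coef_pi // mcoeffD mcoeffZ.
Qed.
HB.instance Definition _ p :=
  GRing.isLinear.Build k R k^o *:%R (coef p) (coef_linear p).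

Lemma coef_nz p r : coef p r != 0 -> nz p.
Proof. by rewrite /coef; case: ifP => //; rewrite eqxx. Qed.

Lemma coef_not_nz p r : ~~ nz p -> coef p r = 0.
Proof. by move=> nzp; rewrite /coef (negPf nzp). Qed.

Lemma coef_mon p q : nz p -> coef p (mon q) = (p == q)%:R.
Proof. by move=> h; rewrite coef_pi // mcoeffU eq_sym. Qed.

Lemma mon_span r : exists (s : seq (qpath Q)) (c : qpath Q -> k),
  r = \sum_(p <- s) c p *: mon p.
Proof.
have [x <-] := pi_surj r; exists (msupp x), (mcoeff^~ x).
rewrite {1}(pathalgE x) raddf_sum /=; apply: eq_bigr => p _.
by rewrite pi_scale.
Qed.

Lemma mon_free n (l : n.-tuple (qpath Q)) : uniq l -> all nz l ->
  free [tuple of map mon l].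
Proof.
move=> ul nl; apply/freeP => c c0 i.
have li : nz (tnth l i) by apply: (allP nl); exact: mem_tnth.
have := congr1 (coef (tnth l i)) c0; rewrite linear0 linear_sum /= => <-.
rewrite (bigD1 i) //= big1 => [|j ji]; last first.
  rewrite linearZ /= (nth_map (tnth l i)) ?size_tuple //.
  rewrite coef_mon // {1}(tnth_nth (tnth l i)) nth_uniq ?size_tuple //.
  by rewrite eq_sym val_eqE (negPf ji) scaler0.
rewrite linearZ /= (nth_map (tnth l i)) ?size_tuple //.
by rewrite coef_mon // -tnth_nth eqxx addr0 -[RHS]/(_ * _) mulr1.
Qed.

Lemma nz_uniq_size (l : seq (qpath Q)) : uniq l -> all nz l ->
  (size l <= \dim {:R})%N.
Proof.
move=> ul nl; have /eqP := @mon_free _ (in_tuple l) ul nl.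
move=> e; have := dimvS (subvf <<[tuple of map mon (in_tuple l)]>>).
by rewrite e size_tuple.
Qed.

(** Distinct nonzero paths are linearly independent, so a duplicate-free list of them has length at
    most dim R; a longest such list misses none. *)
Lemma nz_paths_ex : {l : seq (qpath Q) | uniq l /\ forall p, (p \in l) = nz p}.
Proof.
apply: cid.
pose P n := `[< exists l : seq (qpath Q), [/\ uniq l, all nz l & size l = n] >].
have P0 : exists n, P n by exists 0%N; apply/asboolP; exists [::].
have Pb n : P n -> (n <= \dim {:R})%N.
  by case/asboolP=> l [ul nl <-]; apply: nz_uniq_size.
case: (ex_maxnP P0 Pb) => n /asboolP[l [ul nl sl]] nmax.
exists l; split=> // p; apply/idP/idP; first exact: (allP nl).
move=> nzp; apply: contraT => pl.
have /nmax : P n.+1.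
  by apply/asboolP; exists (p :: l); rewrite /= pl ul nzp nl sl.
by rewrite ltnn.
Qed.
Definition nz_paths := sval nz_paths_ex.

Lemma nz_paths_uniq : uniq nz_paths.
Proof. by rewrite /nz_paths; case: nz_paths_ex => l []. Qed.

Lemma mem_nz_paths p : (p \in nz_paths) = nz p.
Proof. by rewrite /nz_paths; case: nz_paths_ex => l [_ ->]. Qed.

Lemma mon_ind (P : R -> Prop) : P 0 -> (forall c p r, P r -> P (c *: mon p + r)) ->
  forall r, P r.
Proof.
move=> P0 PD r; have [s [c ->]] := mon_span r.
by elim: s => [|p s IHs]; rewrite ?big_nil // big_cons; apply: PD.
Qed.

Lemma coefE r : r = \sum_(p <- nz_paths) coef p r *: mon p.
Proof.
elim/mon_ind: r => [|c p r IHr].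
  by rewrite big1 // => p _; rewrite linear0 scale0r.
under eq_bigr => q _ do rewrite linearP scalerDl.
rewrite big_split /= -IHr; congr (_ + _).
have [nzp|] := boolP (nz p); last first.
  rewrite negbK => /eqP->; rewrite scaler0 big1 // => q _.
  by rewrite linear0 scaler0 scale0r.
rewrite (bigD1_seq p) ?mem_nz_paths ?nz_paths_uniq //= coef_mon // eqxx.
rewrite big1_seq ?addr0 => [|q /andP[qp]]; first by rewrite -[_ *: 1]/(_ * _) mulr1.
by rewrite mem_nz_paths => nzq; rewrite coef_mon // (negPf qp) scaler0 scale0r.
Qed.

Lemma coef_eq (r r' : R) : (forall p, coef p r = coef p r') -> r = r'.
Proof. by move=> e; rewrite (coefE r) (coefE r'); apply: eq_bigr => p _; rewrite e. Qed.

Lemma coef_neq0 (r : R) : r != 0 -> exists p, coef p r != 0.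
Proof.
move=> r0; apply: contrapT => h; move/eqP: r0; apply; apply: coef_eq => p.
rewrite linear0; apply/eqP; apply: contraT => p0; case: h; by exists p.
Qed.

Lemma coef_monl t q p r : qcomp t q = Some p -> nz p ->
  coef p (mon t * r) = coef q r.
Proof.
move=> c nzp; have [_ nzq] := nz_qcomp c nzp.
elim/mon_ind: r => [|a s r IHr]; first by rewrite mulr0 !linear0.
rewrite mulrDr !linearD /= IHr -scalerAr !linearZ /=; congr (_ *: _ + _).
rewrite coef_mon // mon_mul; case c' : (qcomp t s) => [p'|] /=.
  rewrite coef_mon //; congr ((_ : bool)%:R).
  apply/eqP/eqP => [ep|eq]; last by move: c c'; rewrite eq => -> [].
  by apply: qcomp_injr c _; rewrite ep.
rewrite linear0; case: eqP => // eq; by rewrite eq c' in c.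
Qed.

Lemma coef_monr t q p r : qcomp q t = Some p -> nz p ->
  coef p (r * mon t) = coef q r.
Proof.
move=> c nzp; have [nzq _] := nz_qcomp c nzp.
elim/mon_ind: r => [|a s r IHr]; first by rewrite mul0r !linear0.
rewrite mulrDl !linearD /= IHr -scalerAl !linearZ /=; congr (_ *: _ + _).
rewrite coef_mon // mon_mul; case c' : (qcomp s t) => [p'|] /=.
  rewrite coef_mon //; congr ((_ : bool)%:R).
  apply/eqP/eqP => [ep|eq]; last by move: c c'; rewrite eq => -> [].
  by apply: qcomp_injl c _; rewrite ep.
rewrite linear0; case: eqP => // eq; by rewrite eq c' in c.
Qed.

Lemma coef_mul p (r s : R) : coef p (r * s) != 0 ->
  exists q t, [/\ qcomp q t = Some p, coef q r != 0 & coef t s != 0].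
Proof.
move=> p0; have nzp := coef_nz p0; apply: contrapT => h; move/eqP: p0; apply.
rewrite (coefE r) mulr_suml linear_sum /=; apply: big1 => q _.
rewrite (coefE s) mulr_sumr linear_sum /=; apply: big1 => t _.
rewrite -scalerAl -scalerAr !linearZ /= mon_mul.
case c : (qcomp q t) => [p'|] /=; last by rewrite linear0 !scaler0.
rewrite coef_mon //; case: eqP => [e|]; last by rewrite !scaler0.
have [->|q0] := eqVneq (coef q r) 0; first by rewrite scale0r.
have [->|t0] := eqVneq (coef t s) 0; first by rewrite scale0r scaler0.
by case: h; exists q, t; rewrite c e.
Qed.

(** The prefixes of [p], from the lazy path to [p] itself, are [qlen p + 1] distinct nonzero
    paths. *)
Lemma nz_lt p : nz p -> (qlen p < \dim {:R})%N.
Proof.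
move=> nzp.
pose pre i : qpath Q := odflt p (insub (qstart p, take i (qarrows p))).
have preE i : qstart (pre i) = qstart p /\ qarrows (pre i) = take i (qarrows p).
  rewrite /pre; case: insubP => [u _ e|]; first by rewrite /qstart /qarrows e.
  have := qdata_walk p; rewrite -/(qstart p) -/(qarrows p).
  by rewrite -{1}(cat_take_drop i (qarrows p)) is_walk_cat /= => /andP[->].
have := @nz_uniq_size (map pre (iota 0 (qlen p).+1)).
rewrite size_map size_iota; apply.
  rewrite map_inj_in_uniq ?iota_uniq // => i j; rewrite !mem_iota !add0n !ltnS.
  move=> /= ip jp e; have [_ ei] := preE i; have [_ ej] := preE j.
  have := congr1 size ei; rewrite e ej !size_takel //.
apply/allP => _ /mapP[i _ ->]; have [e1 e2] := preE i.
have e3 : qarrows p = qarrows (pre i) ++ drop i (qarrows p).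
  by rewrite e2 cat_take_drop.
have [t c _] := qcomp_prefix (esym e1) e3.
by case: (nz_qcomp c nzp).
Qed.

End MonomialAlgebra.

(** * Maximal paths and socles *)

Section PathModules.
Variables (k : fieldType) (Q : quiver) (S : qpath Q -> Prop) (R : falgType k).
Variable pi : {rmorphism pathalg k Q -> R}.
Hypothesis presR : monomial_presentation S pi.
Implicit Types p q s t u : qpath Q.
Local Notation mon := (mon pi).
Local Notation nz := (nz pi).
Local Notation coef := (coef presR).

Lemma lazy_mul v p : mon (lazy v) * mon p = if v == qend p then mon p else 0.
Proof. by rewrite mon_mul qcomp_lazyl; case: eqP. Qed.

Lemma mul_lazy v p : mon p * mon (lazy v) = if qstart p == v then mon p else 0.
Proof. by rewrite mon_mul qcomp_lazyr; case: eqP. Qed.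

Lemma nz_lazy p : nz p -> nz (lazy (qstart p)) /\ nz (lazy (qend p)).
Proof.
move=> nzp; split.
  by apply: (proj2 (@nz_qcomp _ _ _ pi p (lazy (qstart p)) p _ nzp)); rewrite qcomp_lazyr eqxx.
by apply: (proj1 (@nz_qcomp _ _ _ pi (lazy (qend p)) p p _ nzp)); rewrite qcomp_lazyl eqxx.
Qed.

Lemma nz_arr p a : nz p -> a \in qarrows p -> nz (arr a).
Proof.
move=> nzp /qarrow_factor[s [t [u [c1 c2]]]].
by have [_ nzt] := nz_qcomp c2 nzp; have [] := nz_qcomp c1 nzt.
Qed.

Lemma nz_max (P : qpath Q -> Prop) : (forall p, P p -> nz p) -> (exists p, P p) ->
  exists2 p, P p & forall s, P s -> (qlen s <= qlen p)%N.
Proof.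
move=> Pnz [p Pp].
pose B n := `[< exists2 s, P s & qlen s = n >].
have B0 : exists n, B n by exists (qlen p); apply/asboolP; exists p.
have Bb n : B n -> (n <= \dim {:R})%N.
  by case/asboolP=> s /Pnz /(nz_lt presR)/ltnW h <-.
case: (ex_maxnP B0 Bb) => n /asboolP[q Pq <-] qmax; exists q => // s Ps.
by apply: qmax; apply/asboolP; exists s.
Qed.

(** Some lazy path acts nontrivially on [x], since they sum to 1, and the lengths of nonzero paths
    are bounded; so a longest acting path exists. *)
Lemma max_path (M : lmodType R) (P : M -> Prop) : (exists2 x, P x & x <> 0) ->
  exists p x, [/\ P x, mon p *: x <> 0 &
    forall s y, P y -> (qlen p < qlen s)%N -> mon s *: y = 0].
Proof.
case=> x Px x0.
have [||p [y Py py0] pmax] := @nz_max (fun p => exists2 y, P y & mon p *: y <> 0).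
- by move=> p [y _ h]; apply/eqP => p0; apply: h; rewrite p0 scale0r.
- apply: contrapT => h; apply: x0; rewrite -[x]scale1r -(mon1 pi) scaler_suml.
  rewrite big1 // => v _; apply: contrapT => hv; apply: h.
  by exists (lazy v), x.
exists p, y; split=> // s z Pz lt_ps; apply: contrapT => h.
have /pmax : exists2 y, P y & mon s *: y <> 0 by exists z.
by rewrite leqNgt lt_ps.
Qed.

(* The leftmax paths form a basis of the socle of the left module R. *)
Definition leftmax q := nz q /\
  forall t r, qcomp t q = Some r -> nz r -> qlen t = 0%N.

Lemma leftmax_start v : nz (lazy v) -> exists2 q, leftmax q & qstart q = v.
Proof.
move=> nzv; have [||q [nzq sq] qmax] := @nz_max (fun q => nz q /\ qstart q = v).
- by move=> p [].
- by exists (lazy v).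
exists q => //; split=> // t r c nzr.
have /qmax : nz r /\ qstart r = v by have [_ -> _ _] := qcomp_SomeP c.
by rewrite (qcomp_len c) -{2}[qlen q]addn0 leq_add2l leqn0 => /eqP.
Qed.

Lemma scale_socle (M : lmodType R) (y : M) w r :
  mon (lazy w) *: y = y -> (forall t, (0 < qlen t)%N -> mon t *: y = 0) ->
  r *: y = (coef (lazy w) r)%:A *: y.
Proof.
move=> ey ky.
have h t : t != lazy w -> mon t *: y = 0.
  move=> tw; have [|t0] := posnP (qlen t); last exact: ky.
  move/qlen0_lazy => te; rewrite -ey scalerA te mul_lazy /=.
  rewrite (negPf (_ : qstart (lazy (qstart t)) != w)) ?scale0r //.
  by apply: contraNneq tw => <-; rewrite /= -te.
rewrite {1}(coefE presR r) scaler_suml.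
have [nzw|] := boolP (nz (lazy w)); last first.
  rewrite negbK => /eqP w0; have -> : y = 0 by rewrite -ey w0 scale0r.
  by rewrite scaler0 big1 // => p _; rewrite scaler0.
rewrite (bigD1_seq (lazy w)) ?mem_nz_paths ?nz_paths_uniq //=.
rewrite big1 => [|t /h e]; last by rewrite -mulr_algl -scalerA e scaler0.
rewrite addr0 -[X in X *: y = _]mulr_algl -scalerA. by rewrite ey.
Qed.

Lemma mon_leftmax q r : leftmax q -> r * mon q = coef (lazy (qend q)) r *: mon q.
Proof.
move=> [nzq qmax].
have -> : r * mon q = (coef (lazy (qend q)) r)%:A * mon q; last by rewrite mulr_algl.
apply: (@scale_socle R^o (mon q) (qend q)); first by rewrite [LHS]lazy_mul eqxx.
move=> t t0; rewrite [LHS]mon_mul; case c : (qcomp t q) => [r'|] //=.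
by apply/eqP; apply: contraT => /(qmax _ _ c) e; rewrite e in t0.
Qed.

Lemma coef_mon_mul t p (x : R) : coef p (mon t * x) != 0 ->
  exists2 s, qcomp t s = Some p & coef s x != 0.
Proof.
case/coef_mul=> q [s [c qt sx]]; exists s => //; rewrite -c; congr (qcomp _ _).
apply/esym/eqP; apply: contraNT qt => qt.
have [nzq|nzq] := boolP (nz q); first by rewrite coef_mon // (negPf qt).
by rewrite coef_not_nz.
Qed.

Lemma coef_mul_mon t p (x : R) : coef p (x * mon t) != 0 ->
  exists2 s, qcomp s t = Some p & coef s x != 0.
Proof.
case/coef_mul=> s [q [c sx qt]]; exists s => //; rewrite -c; congr (qcomp _ _).
apply/esym/eqP; apply: contraNT qt => qt.
have [nzq|nzq] := boolP (nz q); first by rewrite coef_mon // (negPf qt).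
by rewrite coef_not_nz.
Qed.

(** Take [t] to be a longest path with t x nonzero: a positive-length path kills t x, so every path
    occurring in t x is maximal. *)
Lemma socle_path (x : R) : x != 0 -> exists2 t, mon t * x != 0 &
  forall p, coef p (mon t * x) != 0 -> leftmax p /\ qend p = qend t.
Proof.
move=> /eqP x0.
have [|t [_ [-> tx0 tmax]]] := @max_path R^o (fun y => y = x); first by exists x.
exists t; first exact/eqP; move=> p px.
have [s c _] := coef_mon_mul px; have [_ _ _ ->] := qcomp_SomeP c; split=> //.
split=> [|t' r c' nzr]; first exact: coef_nz px.
apply/eqP; apply: contraT; rewrite -lt0n => t'0.
move: px; rewrite -(coef_monl presR (mon t * x) c' nzr) mulrA mon_mul.
case c2 : (qcomp t' t) => [t2|] /=; last by rewrite mul0r linear0 eqxx.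
have -> : mon t2 * x = 0.
  by apply: (tmax t2 x erefl); rewrite (qcomp_len c2) -[ltnLHS]addn0 ltn_add2l.
by rewrite linear0 eqxx.
Qed.

(** * Uniserial R e_v and the multiplicity-free socle *)

Section Uniserial.

Definition unique_out := forall a b : arrow Q,
  source a = source b -> nz (arr a) -> nz (arr b) -> a = b.
Hypothesis U : unique_out.

(** The next nonzero arrow is forced at each vertex, so nonzero walks from one vertex form a chain
    under prefixes. *)
Lemma walk_prefix v (l l' : seq (arrow Q)) : is_walk v l -> is_walk v l' ->
  {in l, forall a, nz (arr a)} -> {in l', forall a, nz (arr a)} ->
  (size l <= size l')%N -> exists l2, l' = l ++ l2.
Proof.
elim: l v l' => [|a l IHl] v [|b l'] //=.
- by exists [::].
- by exists (b :: l').
move=> /andP[/eqP sa ws] /andP[/eqP sb ws'] ns ns' le_ll'.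
have ab : a = b.
  by apply: U; rewrite ?sa ?sb //; [apply: ns | apply: ns']; rewrite mem_head.
have [|||l2 ->] := IHl _ l' ws _ _ _ le_ll'.
- by rewrite ab.
- by move=> c cs; apply: ns; rewrite inE cs orbT.
- by move=> c cs; apply: ns'; rewrite inE cs orbT.
by exists l2; rewrite ab.
Qed.

Lemma path_prefix p q : nz p -> nz q -> qstart q = qstart p ->
  (qlen p <= qlen q)%N -> exists t, qcomp t p = Some q.
Proof.
move=> nzp nzq e le_pq.
have [|||s es] := walk_prefix (qdata_walk p) _ _ _ le_pq.
- by rewrite -/(qstart p) -e; exact: (qdata_walk q).
- by move=> a; apply: nz_arr.
- by move=> a; apply: nz_arr.
by have [t c _] := qcomp_prefix e es; exists t.
Qed.

Lemma leftmax_unique p q : leftmax p -> leftmax q -> qstart p = qstart q -> p = q.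
Proof.
wlog le_pq : p q / (qlen p <= qlen q)%N.
  have [h|/ltnW h] := leqP (qlen p) (qlen q) => W lp lq e; first exact: W.
  by apply/esym; apply: W.
move=> [nzp pmax] [nzq _] e.
have [t c] := path_prefix nzp nzq (esym e) le_pq.
by apply/esym; apply: (qcomp_lenr c); rewrite (qcomp_len c) (pmax _ _ c nzq) addn0.
Qed.

End Uniserial.

(** A maximal path spans a copy of the simple module at its end, so this says that no simple module
    occurs twice in the left socle of [R]. *)
Definition unique_socle := forall q q', leftmax q -> leftmax q' ->
  qend q = qend q' -> q = q'.

Definition socle_form (r : R) : k^o :=
  \sum_(p <- nz_paths presR | `[< leftmax p >]) coef p r.

Lemma socle_form_linear : linear socle_form.
Proof.
move=> c x y; rewrite /socle_form scaler_sumr -big_split /=.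
by apply: eq_bigr => p _; rewrite linearP.
Qed.
HB.instance Definition _ :=
  GRing.isLinear.Build k R k^o *:%R socle_form socle_form_linear.

(** Move [x] into the socle by a path [t]: all paths in t x are maximal and share an end, so only
    one occurs and the form returns its nonzero coefficient. *)
Lemma socle_form_nondegenerate (x : R) : unique_socle ->
  (forall r, socle_form (r * x) = 0) -> x = 0.
Proof.
move=> F h; apply/eqP; apply: contraT => /socle_path[t tx0 tm].
have [p px] := coef_neq0 presR tx0; have [lp ep] := tm p px.
have := h (mon t); rewrite /socle_form big_mkcond.
rewrite (bigD1_seq p) ?nz_paths_uniq ?mem_nz_paths ?(coef_nz px) //=.
rewrite asboolT // big1 ?addr0 => [/eqP|q qp]; first by rewrite (negPf px).
case: ifP => // _; apply/eqP; apply: contraT => /tm[lq eq]; case/eqP: qp.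
by apply: F; rewrite // ep.
Qed.

End PathModules.

(** * Generalities on modules *)

Lemma dep_choice (I : Type) (T : I -> Type) (P : forall i, T i -> Prop) :
  (forall i, exists x, P i x) -> exists f : forall i, T i, forall i, P i (f i).
Proof. by move=> h; exists (fun i => sval (cid (h i))) => i; case: cid. Qed.

Section LinearTools.
Variable R : pzRingType.
Implicit Types M N P A B : lmodType R.

Lemma mk_linear M N (f : M -> N) : linear f -> exists F : {linear M -> N}, F =1 f.
Proof.
move=> lf; pose F : {linear M -> N} :=
  HB.pack f (GRing.isLinear.Build R M N *:%R f lf).
by exists F.
Qed.

Lemma linear_injective M N (f : {linear M -> N}) :
  (forall x, f x = 0 -> x = 0) -> injective f.
Proof.
move=> f0 x y e; apply/eqP; rewrite -subr_eq0; apply/eqP/f0.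
by rewrite linearB /= e subrr.
Qed.

Lemma lmod_isoI M N (f : M -> N) (g : N -> M) : linear f ->
  cancel f g -> cancel g f -> lmod_iso M N.
Proof.
move=> lf fg gf; have [F eF] := mk_linear lf; exists F.
by exists g => x; rewrite eF.
Qed.

Lemma lmod_iso_inv M N : lmod_iso M N ->
  exists (f : {linear M -> N}) (g : {linear N -> M}), cancel f g /\ cancel g f.
Proof.
case=> f [g fg gf]; have [|g' eg] := @mk_linear _ _ g.
  by move=> a x y; apply: (can_inj fg); rewrite linearP !gf.
by exists f, g'; split=> x; rewrite eg.
Qed.

Lemma lmod_iso_refl M : lmod_iso M M.
Proof. by apply: (@lmod_isoI _ _ id id). Qed.

Lemma lmod_iso_sym M N : lmod_iso M N -> lmod_iso N M.
Proof. by case/lmod_iso_inv=> f [g [fg gf]]; exists g; exists f. Qed.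

Lemma lmod_iso_trans M N P : lmod_iso M N -> lmod_iso N P -> lmod_iso M P.
Proof.
case/lmod_iso_inv=> f [f' [ff' f'f]] /lmod_iso_inv[g [g' [gg' g'g]]].
apply: (@lmod_isoI _ _ (g \o f) (f' \o g')) => [a x y|x|x] /=.
- by rewrite !linearP.
- by rewrite gg' ff'.
- by rewrite f'f g'g.
Qed.

Lemma finitely_generated_quot M N (f : {linear M -> N}) : surjective f ->
  finitely_generated M -> finitely_generated N.
Proof.
move=> sf [n [g gen]]; exists n, (f \o g) => y; have [x <-] := sf y.
have [c ->] := gen x; exists c; rewrite linear_sum; apply: eq_bigr => i _.
by rewrite linearZ.
Qed.

Lemma finitely_generated_iso M N : lmod_iso M N ->
  finitely_generated M -> finitely_generated N.
Proof.
case/lmod_iso_inv=> f [g [fg gf]]; apply: (@finitely_generated_quot _ _ f) => y.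
by exists (g y).
Qed.

Lemma finitely_generated_summand M N : finitely_generated (M * N)%type ->
  finitely_generated M.
Proof.
have [|p ep] := @mk_linear (M * N)%type M fst; first by [].
by apply: (@finitely_generated_quot _ _ p) => y; exists (y, 0); rewrite ep.
Qed.

Lemma finitely_generated_ffun M (I : finType) (g : I -> M) :
  (forall x, exists c : I -> R, x = \sum_i c i *: g i) -> finitely_generated M.
Proof.
move=> gen; exists #|I|, (g \o enum_val) => x; have [c ->] := gen x.
exists (c \o enum_val); rewrite (reindex (@enum_val I predT)) //.
by apply: onW_bij; exact: enum_val_bij.
Qed.

Lemma finitely_generated_prod M N : finitely_generated M -> finitely_generated N ->
  finitely_generated (M * N)%type.
Proof.
move=> [m [g gM]] [n [h hN]].
have [|i1 e1] := @mk_linear M (M * N)%type (fun x => (x, 0)).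
  by move=> a x y; congr (_, _); rewrite /= ?scaler0 ?addr0.
have [|i2 e2] := @mk_linear N (M * N)%type (fun y => (0, y)).
  by move=> a x y; congr (_, _); rewrite /= ?scaler0 ?addr0.
apply: (@finitely_generated_ffun _ ('I_m + 'I_n)%type
  (fun i => match i with inl i => i1 (g i) | inr j => i2 (h j) end)) => -[x y].
have [c ex] := gM x; have [d ey] := hN y.
exists (fun i => match i with inl i => c i | inr j => d j end).
rewrite big_sumType /=.
under eq_bigr => i _ do rewrite -linearZ.
under [X in _ + X]eq_bigr => i _ do rewrite -linearZ.
by rewrite -!linear_sum -ex -ey e1 e2; congr (_, _); rewrite ?addr0 ?add0r.
Qed.

Lemma prod_lift M N P (f : {linear M -> P}) (g : {linear N -> P}) :
  exists F : {linear (M * N)%type -> P}, forall x y, F (x, y) = f x + g y.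
Proof.
have [|F eF] := @mk_linear (M * N)%type P (fun z => f z.1 + g z.2).
  move=> c [x1 x2] [y1 y2]; rewrite -[LHS]/(f (c *: x1 + y1) + g (c *: x2 + y2)).
  by rewrite (linearP f) (linearP g) scalerDr addrACA.
by exists F => x y; rewrite eF.
Qed.

Lemma injective_extend_prod (E M N P : lmodType R)
    (f : {linear M -> P}) (g : {linear N -> P})
    (f' : {linear M -> E}) (g' : {linear N -> E}) :
  injective_module E -> finitely_generated M -> finitely_generated N ->
  finitely_generated P -> (forall x y, f x + g y = 0 -> x = 0 /\ y = 0) ->
  exists F : {linear P -> E}, (forall x, F (f x) = f' x) /\ (forall y, F (g y) = g' y).
Proof.
move=> injE fgM fgN fgP fg0.
have [i ei] := prod_lift f g; have [h eh] := prod_lift f' g'.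
have inji : injective i.
  by apply: linear_injective => -[x y]; rewrite ei => /fg0[-> ->].
have [F eF] := injE _ _ i h (finitely_generated_prod fgM fgN) fgP inji.
exists F; split=> [x|y].
  by have := eF (x, 0); rewrite ei eh !linear0 !addr0.
by have := eF (0, y); rewrite ei eh !linear0 !add0r.
Qed.

Lemma finitely_generated_free1 : finitely_generated R^o.
Proof.
by exists 1%N, (fun=> 1) => x; exists (fun=> x); rewrite big_ord1 -[RHS]/(_ * _) mulr1.
Qed.

End LinearTools.

Section Kernel.
Variables (R : pzRingType) (M N : lmodType R) (g : {linear M -> N}).

Definition in_ker : {pred M} := fun x => g x == 0.

Lemma in_ker_submod : submod_closed in_ker.
Proof.
split=> [|a x y]; first by rewrite unfold_in linear0.
by rewrite !unfold_in linearP => /eqP-> /eqP->; rewrite scaler0 addr0.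
Qed.
HB.instance Definition _ := GRing.isSubmodClosed.Build R M in_ker in_ker_submod.

Record ker := KerElt { ker_val : M; ker_valP : ker_val \in in_ker }.
HB.instance Definition _ := [isSub for ker_val].
HB.instance Definition _ := [Choice of ker by <:].
HB.instance Definition _ := [SubChoice_isSubLmodule of ker by <:].

End Kernel.

(** The retraction splits [M] as [A] plus the kernel of [g], through x |-> (g x, x - h (g x)). *)
Lemma indecomposable_retract (R : pzRingType) (M A : lmodType R)
    (h : {linear A -> M}) (g : {linear M -> A}) :
  cancel h g -> indecomposable M -> ~ zero_module A -> lmod_iso M A.
Proof.
move=> hg [M0 dM] A0.
have kP x : x - h (g x) \in in_ker g by rewrite unfold_in linearB /= hg subrr.
pose f x : A * ker g := (g x, KerElt (kP x)).
pose f' (y : A * ker g) : M := h y.1 + ker_val y.2.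
have lf : linear f.
  move=> a x y; congr (_, _); first exact: linearP.
  apply: val_inj => /=; rewrite [g _]linearP [h _]linearP scalerBr opprD.
  by rewrite addrACA.
have ff' : cancel f f' by move=> x; rewrite /f' /= addrC subrK.
have f'f : cancel f' f.
  move=> [a [y /= y0]]; have /eqP gy : g y == 0 by [].
  have ga : g (f' (a, KerElt y0)) = a by rewrite /f' linearD /= hg gy addr0.
  congr (_, _) => //; apply: val_inj; rewrite /= ga /f' /= addrC addKr //.
have [//|K0] := dM _ _ (lmod_isoI lf ff' f'f).
apply: (@lmod_isoI _ _ _ g h) => //; first exact: linearP.
by move=> x; have := ff' x; rewrite /f' (K0 (f x).2) addr0.
Qed.

Section PrincipalTools.
Variables (R : pzRingType) (m : R).

Lemma Rm_ex (r : R) : exists x : Rm m, Rm_val x = r * m.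
Proof.
have h : r * m \in in_Rm m by apply/asboolP; exists r.
by exists (RmElt h).
Qed.

Lemma RmP (x : Rm m) : exists r, Rm_val x = r * m.
Proof. by case: x => x /= /asboolP. Qed.

Lemma Rm_val_ex : exists i : {linear Rm m -> R^o}, i =1 @Rm_val R m.
Proof. exact: mk_linear. Qed.

Lemma Rm_lift (M : lmodType R) (y : M) : (forall r, r * m = 0 -> r *: y = 0) ->
  exists h : {linear Rm m -> M}, forall x r, Rm_val x = r * m -> h x = r *: y.
Proof.
move=> ann; pose h x := sval (cid (RmP x)) *: y.
have hE x r : Rm_val x = r * m -> h x = r *: y.
  rewrite /h; case: cid => s /= -> e; apply/eqP; rewrite -subr_eq0 -scalerBl.
  by rewrite ann // mulrBl e subrr.
have [|H eH] := @mk_linear _ _ _ h; last by exists H => x r; rewrite eH; apply: hE.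
move=> a x y'; have [r er] := RmP x; have [s es] := RmP y'.
rewrite (hE x r) // (hE y' s) // (hE _ (a * r + s)) ?scalerDl ?scalerA //.
by rewrite mulrDl -mulrA -er -es.
Qed.

Lemma finitely_generated_Rm : finitely_generated (Rm m).
Proof.
have [x ex] := Rm_ex 1; exists 1%N, (fun=> x) => y; have [r er] := RmP y.
exists (fun=> r); rewrite big_ord1; apply: val_inj.
by rewrite linearZ /= ex er mul1r.
Qed.

End PrincipalTools.

Section DirectSumTools.
Variables (R : pzRingType) (n : nat) (M : 'I_n -> lmodType R).

Lemma dproj_ex i : exists p : {linear dsum M -> M i}, forall x, p x = x i.
Proof. by apply: mk_linear => a x y; rewrite !ffunE. Qed.

Lemma dinj_ex i : exists f : {linear M i -> dsum M},
  (forall x, f x i = x) /\ (forall x j, j != i -> f x j = 0).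
Proof.
pose f (x : M i) : dsum M := [ffun j => dfwith (fun j => 0 : M j) x j].
have fin x : f x i = x by rewrite ffunE dfwith_in.
have fout x j : j != i -> f x j = 0.
  by move=> ji; rewrite ffunE dfwith_out // eq_sym.
have [|F eF] := @mk_linear _ _ _ f; last by exists F; split=> *; rewrite eF ?fin ?fout.
move=> a x y; apply/ffunP => j; have [p ep] := dproj_ex j.
rewrite -[RHS]ep linearP !ep; have [->|ji] := eqVneq j i; first by rewrite !fin.
by rewrite !fout // scaler0 addr0.
Qed.

Lemma dsum_sum (x : dsum M) (f : forall i, {linear M i -> dsum M}) :
  (forall i, (forall x, f i x i = x) /\ (forall x j, j != i -> f i x j = 0)) ->
  x = \sum_i f i (x i).
Proof.
move=> fP; apply/ffunP => j; have [p ep] := dproj_ex j.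
rewrite -!ep linear_sum (bigD1 j) //= big1 ?addr0 => [|i ij].
  by rewrite !ep (proj1 (fP j)).
by rewrite !ep (proj2 (fP i)) // eq_sym.
Qed.

Lemma finitely_generated_dsum :
  (forall i, finitely_generated (M i)) -> finitely_generated (dsum M).
Proof.
move=> fg.
have [f fP] := dep_choice dinj_ex.
have [m gm] := choice fg.
have [g gen] := dep_choice gm.
pose I := {i : 'I_n & 'I_(m i)}.
apply: (@finitely_generated_ffun _ _ I (fun p => f (tag p) (g (tag p) (tagged p)))) => x.
have [c ec] := dep_choice (fun i => gen i (x i)).
exists (fun p => c (tag p) (tagged p)); rewrite {1}(dsum_sum x fP).
under eq_bigr => i _ do rewrite {1}ec linear_sum.
rewrite (@sig_big_dep _ _ _ _ (fun i => 'I_(m i)) xpredT (fun _ => xpredT)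
  (fun i j => f i (c i j *: g i j))) /=.
by apply: eq_bigr => p _; rewrite linearZ.
Qed.

End DirectSumTools.

(** From the covering family keep the least index of each isomorphism class that meets the
    indecomposables in [P]. Since [P] need not be invariant under isomorphism, a module [N] in [P]
    replaces the member kept. *)
Lemma sum_of_indecomposables_ex (R : pzRingType) (P : lmodType R -> Prop) n
    (M : 'I_n -> lmodType R) :
  (forall U, P U -> indecomposable U -> exists i, lmod_iso U (M i)) ->
  exists X : lmodType R, sum_of_indecomposables P X.
Proof.
move=> cov.
pose T i := exists U : lmodType R, [/\ P U, indecomposable U & lmod_iso U (M i)].
pose B := [set i : 'I_n | `[< T i /\ forall j : 'I_n, T j ->
  lmod_iso (M j) (M i) -> (i <= j)%N >]].
have TB (x : 'I_#|B|) : T (enum_val x).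
  by have := enum_valP x; rewrite inE => /asboolP[].
have [N NP] := choice TB.
exists (dsum N); exists #|B|, N; split.
- by move=> i; have [] := NP i.
- move=> i j isoN.
  have {}isoN : lmod_iso (M (enum_val i)) (M (enum_val j)).
    have [_ _ isoi] := NP i; have [_ _ isoj] := NP j.
    apply: lmod_iso_trans isoj; apply: lmod_iso_trans isoN; exact: lmod_iso_sym.
  apply: enum_val_inj; apply/val_inj/eqP; rewrite eqn_leq.
  have := enum_valP i; rewrite inE => /asboolP[_ mi].
  have := enum_valP j; rewrite inE => /asboolP[_ mj].
  by rewrite mi ?mj //; apply: lmod_iso_sym.
- move=> U PU iU; have [i0 iso0] := cov U PU iU.
  have A0 : `[< lmod_iso U (M i0) >] by apply/asboolP.
  case: (@arg_minnP _ i0 (fun i => `[< lmod_iso U (M i) >]) val A0) => i /asboolP isoi imin.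
  have iB : i \in B.
    rewrite inE; apply/asboolP; split; first by exists U.
    move=> j _ isoj; apply: imin; apply/asboolP.
    by apply: lmod_iso_trans isoi _; apply: lmod_iso_sym.
  exists (enum_rank_in iB i); have [_ _] := NP (enum_rank_in iB i).
  rewrite enum_rankK_in // => h; apply: lmod_iso_trans isoi _.
  exact: lmod_iso_sym.
exact: lmod_iso_refl.
Qed.

(** * Torsionless modules and membership in sub(R) *)

Definition torsionless (R : pzRingType) (M : lmodType R) :=
  forall x : M, x <> 0 -> exists f : {linear M -> R^o}, f x <> 0.

Lemma torsionless_iso (R : pzRingType) (M N : lmodType R) :
  lmod_iso M N -> torsionless N -> torsionless M.
Proof.
case/lmod_iso_inv=> f [g [fg gf]] tN x x0; have [|h hx] := tN (f x).
  by move=> fx0; apply: x0; rewrite -(fg x) fx0 linear0.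
have [|F eF] := @mk_linear _ M R^o (h \o f); first by move=> a u v; exact: linearP.
by exists F; rewrite eF.
Qed.

Lemma in_sub_torsionless (R : pzRingType) (M : lmodType R) : in_sub M -> torsionless M.
Proof.
case=> n [U [embU [N /lmod_iso_inv[f [g [fg gf]]]]]] x x0.
have [i fxi] : exists i, f (x, 0) i <> 0.
  apply: contrapT => h; apply: x0.
  have /(congr1 (fun z : M * N => z.1)) := fg (x, 0).
  have -> : f (x, 0) = 0; last by rewrite linear0.
  by apply/ffunP => i; rewrite [RHS]ffunE; apply: contrapT => hi; apply: h; exists i.
have [m [e inje]] := embU i.
have [j ej] : exists j, e (f (x, 0) i) 0 j <> 0.
  apply: contrapT => h; apply: fxi; apply: inje; rewrite linear0.
  apply/rowP => j; rewrite [RHS]mxE; apply: contrapT => hj; apply: h; by exists j.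
have [|F eF] := @mk_linear _ M R^o (fun y => e (f (y, 0) i) 0 j); last by exists F; rewrite eF.
move=> a u v; have [p ep] := dproj_ex U i; rewrite -!ep.
have -> : (a *: u + v, 0) = a *: (u, 0) + (v, 0) :> M * N.
  by congr (_, _); rewrite /= ?scaler0 ?addr0.
by rewrite !linearP !mxE.
Qed.

Lemma in_sub_submodule_free (R : pzRingType) (M : lmodType R) (f : {linear M -> R^o}) :
  injective f -> in_sub M.
Proof.
move=> injf; exists 1%N, (fun=> M); split.
  move=> _; exists 1%N.
  have [|F eF] := @mk_linear _ M 'rV[R]_1 (fun x => const_mx (f x)).
    by move=> a x y; apply/rowP => j; rewrite !mxE linearP.
  by exists F => x y; rewrite !eF => /rowP/(_ 0); rewrite !mxE => /injf.
exists ('rV[R]_0 : lmodType R).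
have [i [iin iout]] := dinj_ex (fun _ : 'I_1 => M) 0.
have [p ep] := dproj_ex (fun _ : 'I_1 => M) 0.
apply: (@lmod_isoI _ _ _ (fun z : M * 'rV[R]_0 => i z.1) (fun x => (p x, 0))).
- by move=> a x y; rewrite /= linearP.
- by move=> [x y] /=; rewrite ep iin; congr (_, _); apply/rowP; case.
- move=> x /=; apply/ffunP => j; rewrite ord1 iin ep //.
Qed.

(** * Endomorphism algebras and submodules of free modules *)

Section FiniteDimensional.
Variables (k : fieldType) (R : falgType k).

(** A subspace of largest dimension inside [P] is all of [P], since any further vector of [P] could
    be adjoined. *)
Lemma subspace_span (V : vectType k) (P : V -> Prop) :
  P 0 -> (forall c x y, P x -> P y -> P (c *: x + y)) ->
  exists W : {vspace V}, forall x, P x <-> x \in W.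
Proof.
move=> P0 PD.
pose B n := `[< exists2 W : {vspace V}, (forall x, x \in W -> P x) & \dim W = n >].
have B0 : exists n, B n.
  exists 0%N; apply/asboolP; exists 0%VS; last exact: dimv0.
  by move=> x; rewrite memv0 => /eqP->.
have Bb n : B n -> (n <= \dim {:V})%N.
  by case/asboolP=> W _ <-; apply: dimvS; exact: subvf.
case: (ex_maxnP B0 Bb) => n /asboolP[W WP <-] Wmax; exists W => x; split; last exact: WP.
move=> Px; have /Wmax : B (\dim (W + <[x]>)%VS).
  apply/asboolP; exists (W + <[x]>)%VS => // y /memv_addP[u uW [w /vlineP[c ->] ->]].
  by rewrite addrC; apply: PD => //; apply: WP.
have sW : (W <= W + <[x]>)%VS by apply: addvSl.
move=> le; have /eqP eW : W == (W + <[x]>)%VS by rewrite eqEdim sW.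
by rewrite eW; apply: (subvP (addvSr W <[x]>)); exact: memv_line.
Qed.

Lemma finitely_generated_embeds (U : lmodType R) :
  embeds_in_free U -> finitely_generated U.
Proof.
case=> n [f injf]; pose V := {ffun 'I_n -> R}.
pose F (u : U) : V := [ffun j => f u 0 j].
have FZ c u w : F (c%:A *: u + w) = c *: F u + F w.
  by apply/ffunP => j; rewrite !ffunE linearP !mxE mulr_algl.
have [||W WP] := @subspace_span V (fun v => exists u, F u = v).
- by exists 0; apply/ffunP => j; rewrite !ffunE linear0 mxE.
- by move=> c _ _ [u <-] [w <-]; exists (c%:A *: u + w).
have gP (i : 'I_(\dim W)) : exists u, F u = (vbasis W)`_i.
  by apply/WP; apply: vbasis_mem; apply: mem_nth; rewrite size_tuple.
have [g eg] := choice gP.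
exists (\dim W), g => x.
have xW : F x \in W by apply/WP; exists x.
exists (fun i => (coord (vbasis W) i (F x))%:A); apply: injf.
apply/rowP => j; have := congr1 (fun v : V => v j) (coord_vbasis xW).
rewrite {1}/F ffunE => ->; rewrite sum_ffunE linear_sum summxE.
apply: eq_bigr => i _; rewrite -eg linearZ !mxE ffunE [F _ _]ffunE.
by rewrite mulr_algl.
Qed.

Lemma in_sub_finitely_generated (M : lmodType R) : in_sub M -> finitely_generated M.
Proof.
case=> n [U [embU [N iso]]]; apply: (@finitely_generated_summand _ M N).
apply: finitely_generated_iso (lmod_iso_sym iso) _.
by apply: finitely_generated_dsum => i; apply: finitely_generated_embeds.
Qed.

(** In a relation between the iterates, cancel [psi] until the lowest coefficient is nonzero; that
    relation would put [x] in the image of [psi]. *)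
Lemma iter_free (E : lmodType k) (psi : {linear E -> E}) (x : E) :
  injective psi -> (forall y, psi y <> x) -> forall N (c : nat -> k),
  \sum_(l < N) c l *: iter l psi x = 0 -> forall l, (l < N)%N -> c l = 0.
Proof.
move=> inj nx; elim=> [|N IHN] c //; rewrite big_ord_recl /=.
pose y := \sum_(i < N) c i.+1 *: iter i psi x.
have -> : \sum_(i < N) c (bump 0 i) *: psi (iter i psi x) = psi y.
  by rewrite linear_sum; apply: eq_bigr => i _; rewrite linearZ.
move=> e; have c0 : c 0%N = 0.
  apply/eqP; apply: contraT => c0.
  case: (nx (- (c 0%N)^-1 *: y)); rewrite linearZ /= scaleNr -scalerN.
  have -> : - psi y = c 0%N *: x by apply/eqP; rewrite eq_sym -addr_eq0 e.
  by rewrite scalerA mulVf // scale1r.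
move: e; rewrite c0 scale0r add0r => /eqP; rewrite -(linear0 psi) => /eqP/inj y0.
by case=> // l lN; apply: (IHN (fun i => c i.+1)).
Qed.

Lemma endo_injective_surjective (M : lmodType R) (psi : {linear endo M -> endo M}) :
  finitely_generated M -> injective psi -> surjective psi.
Proof.
case=> n [g gen] inj x; apply: contrapT => nx.
pose V := {ffun 'I_n * 'I_n -> R}.
pose N := (\dim {:V}).+1.
have liftP (f : endo M) : exists t : V, forall i, f (g i) = \sum_j t (i, j) *: g j.
  have [c ec] := choice (fun i => gen (f (g i))).
  by exists [ffun ij => c ij.1 ij.2] => i; rewrite {1}ec; apply: eq_bigr => j _; rewrite ffunE.
(* [t] records an endomorphism by a matrix over the generators. It need not be linear: a relation
   between matrices still gives the same relation between endomorphisms, and dim V + 1 matrices are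
   dependent. *)
have [t et] := choice liftP.
pose T := [tuple t (iter l psi x) | l < N].
have nfree : ~~ free T.
  rewrite /free size_tuple; apply: contraTN (dimvS (subvf <<T>>)) => /eqP->.
  by rewrite -ltnNge.
case/negP: nfree; apply/freeP => c c0 i.
pose d l := if insub l is Some i then c i else 0 : k.
have dE (l : 'I_N) : d l = c l by rewrite /d valK.
have := @iter_free _ psi x inj _ N d _ i (ltn_ord i); rewrite dE; apply.
  by move=> y ey; apply: nx; exists y.
apply: endoP => y; have [a ->] := gen y; rewrite [LHS]linear_sum [RHS](_ : _ = 0) //.
apply: big1 => j _; rewrite linearZ /=.
have -> : (\sum_(l < N) d l *: iter l psi x : endo M) (g j) =
          \sum_(l < N) (c l)%:A *: (iter l psi x : endo M) (g j).
  rewrite (big_morph (fun f : endo M => f (g j)) (id1 := 0) (op1 := +%R)) //.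
  by apply: eq_bigr => l _; rewrite dE.
under eq_bigr => l _ do rewrite et scaler_sumr.
rewrite exchange_big /= big1 ?scaler0 // => m _.
under eq_bigr => l _ do rewrite scalerA mulr_algl.
rewrite -scaler_suml; have := congr1 (fun v : V => v (j, m)) c0.
rewrite sum_ffunE ffunE => e; rewrite (_ : \sum_(i0 < N) _ = 0) ?scale0r // -[RHS]e.
by apply: eq_bigr => l _; rewrite ffunE -tnth_nth tnth_mktuple.
Qed.

(* The map f -> q (phi f) p is an injective endomorphism of the finite        *)
(* dimensional space End(M), so it hits the identity of M.                    *)
Lemma endo_alg_iso_retract (M N : lmodType R) (p : {linear M -> N}) (q : {linear N -> M}) :
  finitely_generated M -> cancel q p -> endo_alg_iso M N -> surjective q.
Proof.
move=> fgM qp [phi [sphi [phi' phiK _]]].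
pose psi (f : endo M) : endo M := (q \o (phi f : {linear N -> N}) \o p : M -> M).
have psi_lin : linear psi.
  move=> c f f'; apply: endoP => x /=; rewrite rmorphD sphi /=.
  by rewrite linearD; congr (_ + _); rewrite /= /endo_scale_fun linearZ.
have [psiL epsi] := mk_linear psi_lin.
have inj : injective psiL.
  move=> f f'; rewrite !epsi => e; apply: (can_inj phiK); apply: endoP => y.
  have := congr1 (fun h : endo M => p (h (q y))) e.
  by rewrite /= !qp.
have [f ef] := endo_injective_surjective fgM inj (endo_one M).
move=> x; exists ((phi f : {linear N -> N}) (p x)).
by have := congr1 (fun h : endo M => h x) ef; rewrite epsi.
Qed.

(** Matching each summand of SUB with its copy in AUS splits SUB off AUS. A summand of AUS that is
    not torsionless is never matched, so the inclusion [q] would miss it, although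
    [endo_alg_iso_retract] makes [q] onto. *)
Lemma indecomposables_in_sub (AUS SUB : lmodType R) :
  is_AUS AUS -> is_SUB SUB -> endo_alg_iso AUS SUB ->
  forall U : lmodType R, finitely_generated U -> indecomposable U -> torsionless U.
Proof.
move=> [n [M [Mfg Minj Mcov isoM]]] [n' [M' [Msub M'inj M'cov isoM']]] isoE U fgU iU.
have [i0 isoU] := Mcov U fgU iU.
apply: torsionless_iso isoU _; apply: contrapT => ntl.
have sP j : exists i, lmod_iso (M' j) (M i).
  by have [subj indj] := Msub j; apply: Mcov => //; apply: in_sub_finitely_generated.
have [s isos] := choice sP.
have injs : injective s.
  move=> i j e; apply: M'inj; apply: lmod_iso_trans (isos i) _.
  by rewrite e; apply: lmod_iso_sym.
have si0 j : s j != i0.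
  apply/eqP => e; apply: ntl; rewrite -e; apply: torsionless_iso (lmod_iso_sym (isos j)) _.
  by apply: in_sub_torsionless; have [] := Msub j.
have [b] := dep_choice (fun j => lmod_iso_inv (isos j)).
case/dep_choice=> a ab.
have [f fP] := dep_choice (fun i => dinj_ex M i).
have [f' f'P] := dep_choice (fun j => dinj_ex M' j).
have [pr ePr] := dep_choice (fun i => dproj_ex M i).
have [pr' ePr'] := dep_choice (fun j => dproj_ex M' j).
have [al [al' [alK al'K]]] := lmod_iso_inv isoM.
have [be [be' [beK be'K]]] := lmod_iso_inv isoM'.
have [|q eq] := @mk_linear _ SUB AUS (fun y => al' (\sum_j f (s j) (b j (pr' j (be y))))).
  move=> c x y; rewrite -linearP scaler_sumr -big_split /=; congr (al' _).
  by apply: eq_bigr => j _; rewrite !linearP.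
have [|p ep] := @mk_linear _ AUS SUB (fun x => be' (\sum_j f' j (a j (pr (s j) (al x))))).
  move=> c x y; rewrite -linearP scaler_sumr -big_split /=; congr (be' _).
  by apply: eq_bigr => j _; rewrite !linearP.
have qp : cancel q p.
  move=> y; rewrite ep eq al'K; apply: (can_inj beK); rewrite be'K.
  rewrite [RHS](dsum_sum _ f'P); apply: eq_bigr => j _; congr (f' j _).
  rewrite linear_sum (bigD1 j) //= big1 => [|j' j'j].
    by rewrite addr0 !ePr (proj1 (fP _)) (proj1 (ab j)) ePr'.
  by rewrite ePr (proj2 (fP _)) // (inj_eq injs) eq_sym.
have fgA : finitely_generated AUS.
  apply: finitely_generated_iso (lmod_iso_sym isoM) _.
  by apply: finitely_generated_dsum => i; have [] := Mfg i.
have sq := endo_alg_iso_retract fgA qp isoE.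
have [_ [nz0 _]] := Mfg i0; apply: nz0 => z.
have [y ey] := sq (al' (f i0 z)).
rewrite -(proj1 (fP i0) z) -ePr -(al'K (f i0 z)) -ey eq al'K linear_sum.
by apply: big1 => j _; rewrite ePr (proj2 (fP _)) // eq_sym.
Qed.

End FiniteDimensional.

(** * Nondegenerate forms *)

Section NondegenerateForm.
Variables (k : fieldType) (R : falgType k).

Lemma functional_extension (V : vectType k) (W : {vspace V}) (mu : V -> k^o) :
  (forall c x y, x \in W -> y \in W -> mu (c *: x + y) = c *: mu x + mu y) ->
  exists L : {linear V -> k^o}, forall x, x \in W -> L x = mu x.
Proof.
move=> muP.
have mu0 : mu 0 = 0.
  have := muP 1 0 0 (mem0v W) (mem0v W); rewrite !scale1r addr0 => /eqP.
  by rewrite -subr_eq0 opprD addrA subrr sub0r oppr_eq0 => /eqP.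
pose L v : k^o := \sum_i coord (vbasis W) i (projv W v) *: mu (vbasis W)`_i.
have [|F eF] := @mk_linear k V k^o L.
  move=> c x y; rewrite /L scaler_sumr -big_split /=; apply: eq_bigr => i _.
  by rewrite !linearP scalerDl scalerA.
exists F => x xW; rewrite eF /L projv_id // [in RHS](coord_vbasis xW).
have muS : forall (I : Type) (r : seq I) (c : I -> k) (b : I -> V),
    (forall i, b i \in W) -> (\sum_(i <- r) c i *: b i \in W) /\
    mu (\sum_(i <- r) c i *: b i) = \sum_(i <- r) c i *: mu (b i).
  move=> I r c b bW; elim: r => [|i r [IH1 IH2]]; first by rewrite !big_nil mem0v.
  by rewrite !big_cons memvD ?memvZ // muP // IH2.
by rewrite (proj2 (muS _ _ _ _ _)) // => i; apply: vbasis_mem; apply: mem_nth; rewrite size_tuple.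
Qed.

Variable lam : {linear R -> k^o}.
Hypothesis lam_nondeg : forall x, (forall r, lam (r * x) = 0) -> x = 0.

Lemma form_cancel x y : (forall r, lam (r * x) = lam (r * y)) -> x = y.
Proof.
move=> e; apply/eqP; rewrite -subr_eq0; apply/eqP; apply: lam_nondeg => r.
by rewrite mulrBr linearB /= e subrr.
Qed.

(** Nondegeneracy makes y |-> lam (_ y) injective from [R] to its dual, hence onto by dimension. In
    the proof [th] is this map, with the dual identified with [R] through a basis. *)
Lemma form_represents (phi : {linear R -> k^o}) : exists y, forall r, phi r = lam (r * y).
Proof.
pose e := vbasis {:R}.
have eP r : r = \sum_i coord e i r *: e`_i by apply: coord_vbasis; exact: memvf.
have freeE (c d : 'I_(\dim {:R}) -> k) :
    \sum_i c i *: e`_i = \sum_i d i *: e`_i -> forall i, c i = d i.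
  move=> cd i; have := congr1 (coord e i) cd.
  by rewrite !coord_sum_free // (basis_free (vbasisP _)).
have [|th eth] := @mk_linear k R R (fun y => \sum_(i < \dim {:R}) (lam (e`_i * y) : k) *: e`_i).
  move=> c x y; rewrite scaler_sumr -big_split /=; apply: eq_bigr => i _.
  by rewrite mulrDr -scalerAr linearP scalerDl scalerA.
have ker0 : lker (linfun th) == 0%VS.
  apply/lker0P => x y; rewrite !lfunE /= !eth => /freeE exy.
  apply: form_cancel => r; rewrite (eP r) !mulr_suml !linear_sum.
  by apply: eq_bigr => i _; rewrite -!scalerAl !linearZ /= exy.
have img : limg (linfun th) = fullv.
  apply/eqP; rewrite eqEdim subvf limg_dim_eq ?leqnn //=.
  by have /eqP -> := ker0; rewrite capv0.
have : \sum_(i < \dim {:R}) (phi e`_i : k) *: e`_i \in limg (linfun th) by rewrite img memvf.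
case/memv_imgP=> y _; rewrite lfunE /= eth => /freeE ey; exists y => r.
rewrite (eP r) !mulr_suml !linear_sum.
by apply: eq_bigr => i _; rewrite -!scalerAl !linearZ /= ey.
Qed.

(* An R-linear map into R amounts, by composing with lam, to a k-linear       *)
(* functional, and functionals extend.                                        *)
Lemma nondegenerate_form_self_injective : self_injective R.
Proof.
move=> A B i f _ [n [g gen]] inj; pose V := {ffun 'I_n -> R}.
pose pr (v : V) : B := \sum_j v j *: g j.
pose act (r : R) (v : V) : V := [ffun j => r * v j].
have prD c v w : pr (c *: v + w) = c%:A *: pr v + pr w.
  rewrite /pr scaler_sumr -big_split /=; apply: eq_bigr => j _.
  by rewrite !ffunE scalerDl scalerA mulr_algl.
have prA r v : pr (act r v) = r *: pr v.
  rewrite /pr scaler_sumr; apply: eq_bigr => j _.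
  by rewrite !ffunE scalerA.
have prS b : exists v, pr v = b.
  have [c ->] := gen b; exists [ffun j => c j]; apply: eq_bigr => j _.
  by rewrite ffunE.
have lamA c x : lam (c%:A * x) = c *: lam x by rewrite mulr_algl linearZ.
(* The functional [lam] after [f], pulled back to the vectors of [V] that represent elements of the
   image of [i]; the value 0 elsewhere is arbitrary. *)
pose mu v : k^o := if pselect (exists a, i a = pr v) is left e then lam (f (sval (cid e))) else 0.
have muE v a : i a = pr v -> mu v = lam (f a).
  rewrite /mu => e; case: pselect => [e'|[]]; last by exists a.
  by case: cid => a' /= ea'; congr (lam (f _)); apply: inj; rewrite ea'.
have [||W WP] := @subspace_span k V (fun v => exists a, i a = pr v).
- by exists 0; rewrite linear0 /pr big1 // => j _; rewrite ffunE scale0r.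
- by move=> c x y [a ea] [b eb]; exists (c%:A *: a + b); rewrite linearP ea eb prD.
have [|L LE] := @functional_extension V W mu.
  move=> c x y /WP[a ea] /WP[b eb]; rewrite (muE x a) // (muE y b) //.
  rewrite (muE _ (c%:A *: a + b)); last by rewrite linearP ea eb prD.
  by rewrite linearP linearD lamA.
have LEa v a : i a = pr v -> L v = lam (f a).
  by move=> e; rewrite LE ?(muE v a) //; apply/WP; exists a.
have GP b : exists y, forall v, pr v = b -> forall r, L (act r v) = lam (r * y).
  have [v ev] := prS b.
  have [|phi ephi] := @mk_linear k R k^o (fun r => L (act r v)).
    move=> c r s; rewrite -linearP; congr (L _); apply/ffunP => j.
    by rewrite !ffunE mulrDl -scalerAl.
  (* The [y] found for one lift [v] of [b] serves every lift, because two lifts differ by a vector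
     representing 0, where [L] vanishes. *)
  have [y ey] := form_represents phi; exists y => w ew r; rewrite -ey ephi.
  apply/eqP; rewrite -subr_eq0 -linearB; apply/eqP.
  rewrite (@LEa _ 0) ?linear0 //.
  have -> : act r w - act r v = (-1) *: act r v + act r w.
    by rewrite scaleN1r addrC.
  by rewrite prD !prA ew ev scaleNr scale1r scaleN1r addNr.
have [G GE] := choice GP.
have [|F eF] := @mk_linear R B R^o G.
  move=> a x y; apply: form_cancel => r; have [v ev] := prS x; have [w ew] := prS y.
  rewrite -(GE _ (act a v + w)); last first.
    by have := prD 1 (act a v) w; rewrite !scale1r prA ev ew.
  rewrite mulrDr linearD /= -(GE _ _ ew) mulrA -(GE _ _ ev) -linearD.
  congr (L _); apply/ffunP => j; by rewrite !ffunE mulrDr mulrA.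
exists F => a; rewrite eF; apply: form_cancel => r; have [v ev] := prS (i a).
rewrite -(GE _ _ ev) (@LEa _ (r *: a)); first by rewrite linearZ.
by rewrite prA ev linearZ.
Qed.

End NondegenerateForm.

(** * Cyclic quotients of R e_v *)

Section Nilpotency.
Variables (k : fieldType) (Q : quiver) (S : qpath Q -> Prop) (R : falgType k).
Variable pi : {rmorphism pathalg k Q -> R}.
Hypothesis presR : monomial_presentation S pi.
Implicit Types p q s t u : qpath Q.
Local Notation mon := (mon pi).
Local Notation nz := (nz pi).
Local Notation coef := (coef presR).

(** A lazy path factors only as itself times itself. *)
Lemma coef_lazy_mul v (x y : R) :
  coef (lazy v) (x * y) = coef (lazy v) x * coef (lazy v) y.
Proof.
have [nzv|nzv] := boolP (nz (lazy v)); last first.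
  by rewrite !coef_not_nz // mul0r.
rewrite {1}(coefE presR x) mulr_suml linear_sum /=.
rewrite (bigD1_seq (lazy v)) ?nz_paths_uniq ?mem_nz_paths //=.
rewrite big1 => [|t tv]; last first.
  apply/eqP; apply: contraT; rewrite -scalerAl linearZ /= => h.
  have /coef_mon_mul[s c _] : coef (lazy v) (mon t * y) != 0.
    by apply: contraNneq h => ->; rewrite scaler0.
  have := qcomp_len c; rewrite /qlen /= => /esym/eqP.
  rewrite addn_eq0 => /andP[_ /eqP/qlen0_lazy t0].
  have [_ _ _ ev] := qcomp_SomeP c; case/eqP: tv; rewrite t0; congr lazy.
  by rewrite -[RHS]/(qend (lazy v)) ev t0.
rewrite addr0 -scalerAl linearZ /=; congr (_ * _).
by apply: coef_monl; rewrite // qcomp_lazyl eqxx.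
Qed.

(** Every path in the i-th power of [x] has length at least i, and nonzero paths have bounded
    length. *)
Lemma nilpotent_coef (x : R) : (forall v, coef (lazy v) x = 0) ->
  exists N, x ^+ N = 0.
Proof.
move=> x0; exists (\dim {:R}).
have h i q : coef q (x ^+ i) != 0 -> (i <= qlen q)%N.
  elim: i q => // i IHi q; rewrite exprS => /coef_mul[s [t [c sx /IHi it]]].
  rewrite (qcomp_len c) -addn1 leq_add // lt0n; apply: contraNneq sx => /qlen0_lazy->.
  by rewrite x0.
apply/eqP; apply: contraT => /(coef_neq0 presR)[p hp]; have := h _ _ hp.
by rewrite leqNgt (nz_lt presR) // (coef_nz hp).
Qed.

Lemma idempotent_eq0 (x : R) : x * x = x -> (forall v, coef (lazy v) x = 0) -> x = 0.
Proof.
move=> xx /nilpotent_coef[[|N]]; first by move/eqP; rewrite expr0 oner_eq0.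
suff -> : x ^+ N.+1 = x by [].
by elim: N => [|N IHN]; rewrite ?expr1 // exprS IHN.
Qed.

(** The constant terms at [v] of [e1] and [e2] are idempotent scalars with sum 1. The summand whose
    term is 0 has no constant term at all, so it is a nilpotent idempotent. *)
Lemma primitive_lazy v : nz (lazy v) -> primitive_idempotent (mon (lazy v)).
Proof.
move=> nzv; split; first by rewrite lazy_mul eqxx.
  exact/eqP.
move=> e1 e2 e11 e22 e12 e21 e.
have sum1 : coef (lazy v) e1 + coef (lazy v) e2 = 1.
  by have := congr1 (coef (lazy v)) e; rewrite linearD /= coef_mon // eqxx.
have zero f : f * f = f -> mon (lazy v) * f = f -> coef (lazy v) f = 0 -> f = 0.
  move=> ff ef f0; apply: idempotent_eq0 => // w.
  have [->//|wv] := eqVneq w v; apply/eqP; apply: contraT; rewrite -ef.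
  rewrite coef_lazy_mul; have [nzw|nzw] := boolP (nz (lazy w)); last first.
    by rewrite coef_not_nz // mul0r eqxx.
  by rewrite coef_mon // lazy_eq (negPf wv) mul0r eqxx.
have e1v : mon (lazy v) * e1 = e1 by rewrite e mulrDl e11 e21 addr0.
have e2v : mon (lazy v) * e2 = e2 by rewrite e mulrDl e22 e12 add0r.
have [c0|c0] := eqVneq (coef (lazy v) e1) 0; first by left; apply: zero.
right; apply: zero => //; have c1 : coef (lazy v) e1 = 1.
  by apply: (mulfI c0); rewrite mulr1 -coef_lazy_mul e11.
by move/eqP: sum1; rewrite c1 -subr_eq0 addrAC subrr add0r => /eqP.
Qed.

End Nilpotency.

Section Truncation.
Variables (k : fieldType) (Q : quiver) (S : qpath Q -> Prop) (R : falgType k).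
Variable pi : {rmorphism pathalg k Q -> R}.
Variable presR : monomial_presentation S pi.
Variable v : vertex Q.
Variable K : pred (qpath Q).
Hypothesis K_factor : forall t q r, qcomp t q = Some r -> K r -> K q.
Hypothesis K_start : forall p, K p -> qstart p = v.
Hypothesis K_lazy : K (lazy v).
Hypothesis nz_v : nz pi (lazy v).
Implicit Types p q s t u : qpath Q.
Local Notation mon := (mon pi).
Local Notation nz := (nz pi).
Local Notation coef := (coef presR).

(* trunc below is the quotient of R e_v by the span of the paths outside K,  *)
(* realised on the complement spanned by the paths in K; K_factor says that  *)
(* the paths outside K span a left ideal.                                    *)
Definition truncate (x : R) : R :=
  \sum_(p <- nz_paths presR | K p) coef p x *: mon p.

Lemma truncate_linear : linear truncate.
Proof.
move=> c x y; rewrite /truncate scaler_sumr -big_split /=.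
by apply: eq_bigr => p _; rewrite linearP scalerDl scalerA.
Qed.
HB.instance Definition _ := GRing.isLinear.Build k R R *:%R truncate truncate_linear.

Lemma coef_truncate p x : coef p (truncate x) = if K p then coef p x else 0.
Proof.
have [nzp|nzp] := boolP (nz p); last by rewrite !coef_not_nz // if_same.
rewrite /truncate linear_sum /= big_mkcond (bigD1_seq p) ?nz_paths_uniq ?mem_nz_paths //=.
rewrite big1 ?addr0 => [|q qp]; last first.
  by case: ifP => // _; rewrite linearZ /= coef_mon // eq_sym (negPf qp) scaler0.
by case: ifP => // _; rewrite linearZ /= coef_mon // eqxx -[LHS]/(_ * _) mulr1.
Qed.

Lemma truncate_id x : truncate (truncate x) = truncate x.
Proof. by apply: (@coef_eq _ _ _ _ _ presR) => p; rewrite !coef_truncate; case: (K p). Qed.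

(** Left multiples of a discarded path are discarded too, by [K_factor]. *)
Lemma truncate_mul r x : truncate (r * truncate x) = truncate (r * x).
Proof.
apply: (@coef_eq _ _ _ _ _ presR) => p; rewrite !coef_truncate; case: ifP => // Kp.
apply/eqP; rewrite -subr_eq0 -linearB -mulrBr.
apply: contraT => /coef_mul[q [t [c _]]].
by rewrite linearB /= coef_truncate (K_factor c Kp) subrr eqxx.
Qed.

Definition in_trunc : {pred R} := fun x => truncate x == x.

Lemma in_trunc_zmod : zmod_closed in_trunc.
Proof.
split=> [|x y]; first by rewrite unfold_in linear0.
by rewrite !unfold_in linearB /= => /eqP-> /eqP->.
Qed.
HB.instance Definition _ := GRing.isZmodClosed.Build R in_trunc in_trunc_zmod.

Record trunc := TruncElt { trunc_val : R; trunc_valP : trunc_val \in in_trunc }.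
HB.instance Definition _ := [isSub for trunc_val].
HB.instance Definition _ := [Choice of trunc by <:].
HB.instance Definition _ := [SubChoice_isSubZmodule of trunc by <:].

Lemma truncate_in x : truncate x \in in_trunc.
Proof. by rewrite unfold_in truncate_id. Qed.

Definition trunc_of (x : R) : trunc := TruncElt (truncate_in x).
Definition trunc_scale (r : R) (x : trunc) : trunc := trunc_of (r * trunc_val x).

Lemma trunc_valK (x : trunc) : truncate (trunc_val x) = trunc_val x.
Proof. by have := trunc_valP x; rewrite unfold_in => /eqP. Qed.

Lemma trunc_scaleA a b x : trunc_scale a (trunc_scale b x) = trunc_scale (a * b) x.
Proof. by apply: val_inj; rewrite /= truncate_mul mulrA. Qed.
Lemma trunc_scale1 : left_id 1 trunc_scale.
Proof. by move=> x; apply: val_inj; rewrite /= mul1r trunc_valK. Qed.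
Lemma trunc_scaleDr : right_distributive trunc_scale +%R.
Proof. by move=> a x y; apply: val_inj; rewrite /= mulrDr linearD. Qed.
Lemma trunc_scaleDl x : {morph trunc_scale^~ x : a b / a + b}.
Proof. by move=> a b; apply: val_inj; rewrite /= mulrDl linearD. Qed.
HB.instance Definition _ := GRing.Zmodule_isLmodule.Build R trunc
  trunc_scaleA trunc_scale1 trunc_scaleDr trunc_scaleDl.

Definition trunc_module : lmodType R := trunc.

Lemma trunc_val_scale r (x : trunc) : trunc_val (r *: x) = truncate (r * trunc_val x).
Proof. by []. Qed.

Lemma coef_trunc p (x : trunc) : ~~ K p -> coef p (trunc_val x) = 0.
Proof. by move=> Kp; rewrite -trunc_valK coef_truncate (negPf Kp). Qed.

Definition trunc_gen : trunc := trunc_of (mon (lazy v)).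

Lemma trunc_genE : trunc_val trunc_gen = mon (lazy v).
Proof.
apply: (@coef_eq _ _ _ _ _ presR) => p; rewrite coef_truncate; case: ifP => // Kp.
have [nzp|nzp] := boolP (nz p); last by rewrite coef_not_nz.
rewrite coef_mon //; case: eqP => // ep; by rewrite ep K_lazy in Kp.
Qed.

Lemma trunc_val_lazy (x : trunc) : trunc_val x * mon (lazy v) = trunc_val x.
Proof.
apply: (@coef_eq _ _ _ _ _ presR) => p.
have [nzp|nzp] := boolP (nz p); last by rewrite !coef_not_nz.
have [Kp|Kp] := boolP (K p).
  by apply: coef_monr => //; rewrite qcomp_lazyr (K_start Kp) eqxx.
rewrite (coef_trunc _ Kp); apply/eqP; apply: contraT => /coef_mul_mon[s c].
have -> : s = p.
  have [es _ ep _] := qcomp_SomeP c; apply: qpath_eq; rewrite ?ep //.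
  by rewrite es; have [_ -> _ _] := qcomp_SomeP c.
by rewrite coef_trunc ?eqxx.
Qed.

Lemma trunc_cyclic (x : trunc) : x = trunc_val x *: trunc_gen.
Proof.
apply: val_inj; rewrite [RHS]trunc_val_scale trunc_genE trunc_val_lazy.
by rewrite trunc_valK.
Qed.

Lemma trunc_finitely_generated : finitely_generated trunc.
Proof.
exists 1%N, (fun=> trunc_gen) => x; exists (fun=> trunc_val x).
by rewrite big_ord1 -trunc_cyclic.
Qed.

(* The elements with vanishing constant term form the largest proper submodule. *)
Lemma trunc_generates (x : trunc) : coef (lazy v) (trunc_val x) != 0 ->
  exists r, r *: x = trunc_gen.
Proof.
set c := coef _ _ => c0; pose e := mon (lazy v).
have ee : e * e = e by rewrite /e lazy_mul eqxx.
(* [n] has no constant terms, hence is nilpotent, and the geometric sum [r0] inverts 1 - n. As (1 -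
   n) e is the multiple c^-1 e x of [x], this recovers the generator. *)
pose n := e - c^-1 *: (e * trunc_val x).
have ne : n * e = n by rewrite mulrBl ee -scalerAl -mulrA trunc_val_lazy.
have en : e * n = n by rewrite mulrBr ee -scalerAr mulrA ee.
have [w|N nN] := @nilpotent_coef _ _ _ _ _ presR n.
  have cv : coef (lazy v) e = 1 by rewrite coef_mon // eqxx.
  have [->|wv] := eqVneq w v.
    rewrite linearB linearZ /= coef_lazy_mul cv mul1r -/c.
    by rewrite -[_ *: _]/(_ * _) mulVf // subrr.
  rewrite -en coef_lazy_mul; have [nzw|nzw] := boolP (nz (lazy w)); last first.
    by rewrite coef_not_nz // mul0r.
  by rewrite coef_mon // lazy_eq (negPf wv) mul0r.
pose r0 := \sum_(i < N) n ^+ i.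
have r01 : r0 * (1 - n) = 1.
  have comm : GRing.comm (1 - n) r0.
    apply: commr_sum => i _; apply: commrX; apply: commr_sym.
    by apply: commrB; first exact: commr1.
  have := subrX1 n N; rewrite nN sub0r -/r0 => h.
  by rewrite -comm -[1 - n]opprB mulNr -h opprK.
exists (r0 * (c^-1 *: e)); apply: val_inj; rewrite [LHS]trunc_val_scale /=.
congr truncate; rewrite -mulrA -scalerAl.
have -> : c^-1 *: (e * trunc_val x) = (1 - n) * e.
  by rewrite mulrBl ne mul1r opprB addrC subrK.
by rewrite mulrA r01 mul1r.
Qed.

(** The components of the generator in a decomposition have constant terms with sum 1, so one of
    them generates the whole module and the other factor vanishes. *)
Lemma trunc_indecomposable : indecomposable trunc.
Proof.
have gen1 : coef (lazy v) (trunc_val trunc_gen) = 1.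
  by rewrite trunc_genE coef_mon // eqxx.
split.
  move=> /(_ trunc_gen) /(congr1 (fun x => coef (lazy v) (trunc_val x))).
  by rewrite gen1 linear0 => /eqP; rewrite oner_eq0.
move=> A B /lmod_iso_inv[f [f' [fK f'K]]].
pose a := f' ((f trunc_gen).1, 0); pose b := f' (0, (f trunc_gen).2).
have sum1 : coef (lazy v) (trunc_val a) + coef (lazy v) (trunc_val b) = 1.
  rewrite -linearD -gen1 -[trunc_val a + _]/(trunc_val (a + b)) -linearD.
  congr (coef _ (trunc_val _)); rewrite -[RHS]fK; congr (f' _).
  by case: (f trunc_gen) => x y; congr (_, _); rewrite /= ?addr0 ?add0r.
have [a0|a0] := eqVneq (coef (lazy v) (trunc_val a)) 0.
  left=> x; have [|r er] := @trunc_generates b.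
    by move: sum1; rewrite a0 add0r => ->; exact: oner_neq0.
  have : (f (f' (x, 0))).1 = 0.
    rewrite (trunc_cyclic (f' (x, 0))) -er !linearZ /= f'K /=.
    by rewrite !scaler0.
  by rewrite f'K.
right=> x; have [r er] := trunc_generates a0.
have : (f (f' (0, x))).2 = 0.
  rewrite (trunc_cyclic (f' (0, x))) -er !linearZ /= f'K /=.
  by rewrite !scaler0.
by rewrite f'K.
Qed.

End Truncation.

(** * Torsionless indecomposables *)

Section TorsionlessIndecomposables.
Variables (k : fieldType) (Q : quiver) (S : qpath Q -> Prop) (R : falgType k).
Variable pi : {rmorphism pathalg k Q -> R}.
Variable presR : monomial_presentation S pi.
Hypothesis tlR : forall U : lmodType R,
  finitely_generated U -> indecomposable U -> torsionless U.
Implicit Types p q s t u : qpath Q.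
Local Notation mon := (mon pi).
Local Notation nz := (nz pi).
Local Notation coef := (coef presR).
Local Notation leftmax := (leftmax pi).

(** [x] is the image of the generator under a map to [R] that does not vanish on [r] times the
    generator. *)
Lemma trunc_torsionless v (K : pred (qpath Q)) r :
  (forall t q s, qcomp t q = Some s -> K s -> K q) ->
  (forall p, K p -> qstart p = v) -> K (lazy v) -> nz (lazy v) ->
  truncate presR K (r * mon (lazy v)) != 0 ->
  exists x : R, [/\ mon (lazy v) * x = x, r * x != 0 &
    forall s : R, truncate presR K (s * mon (lazy v)) = 0 -> s * x = 0].
Proof.
move=> Kf Ks Kl nzv r0.
pose T := trunc_module presR Kf.
pose g : T := trunc_gen presR v K.
have gE (s : R) : trunc_val (s *: g) = truncate presR K (s * mon (lazy v)).
  by rewrite trunc_val_scale trunc_genE.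
have [|||phi phir] := @tlR T _ _ (r *: g).
- exact: (trunc_finitely_generated presR Kf Ks Kl).
- exact: (trunc_indecomposable presR Kf Ks Kl nzv).
- by move=> h; move: r0; rewrite -gE h eqxx.
exists (phi g); split.
- rewrite -[LHS]linearZ; congr (phi _); apply: val_inj.
  by rewrite [LHS]gE lazy_mul eqxx.
- by apply/eqP; rewrite -[r * _]linearZ.
- move=> s s0; rewrite -[LHS]linearZ (_ : s *: g = 0) ?linear0 //.
  by apply: val_inj; rewrite [LHS]gE.
Qed.

(** Truncating R e_w to its lazy path gives the simple module at [w]. Its generator maps to some
    nonzero [x] killed by all positive-length paths, so each path in [x] is maximal and ends at
    [w]. *)
Lemma leftmax_end_torsionless w : nz (lazy w) -> exists2 q, leftmax q & qend q = w.
Proof.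
move=> nzw.
have trE x p : coef p (truncate presR (pred1 (lazy w)) x) =
    if p == lazy w then coef p x else 0 by rewrite coef_truncate.
have lz t q : qcomp t q = Some (lazy w) -> qlen t = 0%N /\ q = lazy w.
  move=> c; have := qcomp_len c; rewrite /qlen /= => /esym/eqP.
  rewrite addn_eq0 => /andP[/eqP q0 /eqP t0]; split=> //.
  have [_ e _ _] := qcomp_SomeP c; rewrite (qlen0_lazy q0) -e //.
have [|||||x [wx x0 kx]] := @trunc_torsionless w (pred1 (lazy w)) 1.
- by move=> t q s c /eqP es; move: c; rewrite es => /lz[_ ->]; exact/eqP.
- by move=> p /eqP->.
- exact/eqP.
- exact: nzw.
- apply/eqP => /(congr1 (coef (lazy w))); rewrite trE eqxx mul1r linear0.
  by rewrite coef_mon // eqxx => /eqP; rewrite oner_eq0.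
rewrite mul1r in x0; have [p px] := coef_neq0 presR x0.
have nzp := coef_nz px.
have pw : qend p = w.
  have : coef p (mon (lazy w) * x) != 0 by rewrite wx.
  by case/coef_mon_mul=> s /qcomp_SomeP[_ _ _ ->].
exists p => //; split=> // t r c nzr; apply/eqP; apply: contraT; rewrite -lt0n => t0.
move: px; rewrite -(coef_monl presR x c nzr) kx ?linear0 ?eqxx //.
apply: (@coef_eq _ _ _ _ _ presR) => q; rewrite trE linear0.
case: eqP => // ->; apply/eqP; apply: contraT => /coef_mon_mul[s /lz[]].
by move=> e; rewrite e in t0.
Qed.

(* This p is found by embedding the cyclic module R e_v / R b in a free module. *)
Lemma separating_path a b : source a = source b -> a <> b -> nz (arr a) ->
  exists p, mon (arr a) * mon p != 0 /\ mon (arr b) * mon p = 0.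
Proof.
move=> ab nab nza; set v := source a.
(* The paths from [v] that do not begin with [b]; the remaining nonzero paths from [v] span R b. *)
pose K p := (qstart p == v) && (ohead (qarrows p) != Some b).
have nzv : nz (lazy v) := proj1 (nz_lazy nza).
have [|||||x [vx x0 kx]] := @trunc_torsionless v K (mon (arr a)).
- move=> t q s /qcomp_SomeP[_ e1 e2 _]; rewrite /K e1 e2.
  by case: (qarrows q) => [/andP[->]|].
- by move=> p /andP[/eqP].
- by rewrite /K /= eqxx.
- exact: nzv.
- rewrite mul_lazy eqxx; apply/eqP => /(congr1 (coef (arr a))).
  rewrite coef_truncate linear0 /K /= eqxx /=.
  have -> : (Some a == Some b) = false by apply/eqP => -[].
  by rewrite coef_mon // eqxx => /eqP; rewrite oner_eq0.
have [u ux] := coef_neq0 presR x0; have [p c px] := coef_mon_mul ux.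
exists p; split; first by rewrite mon_mul c; apply: coef_nz ux.
rewrite mon_mul; case cb : (qcomp (arr b) p) => [u'|] //=.
apply/eqP; apply: contraT => nzu'; move: px.
rewrite -(coef_monl presR x cb nzu') kx ?linear0 ?eqxx //.
rewrite mul_lazy [qstart _ == _](_ : _ = true); last by rewrite /v ab; exact: eqxx.
apply: (@coef_eq _ _ _ _ _ presR) => q; rewrite coef_truncate linear0.
case: ifP => // /andP[_ qb]; have [nzq|nzq] := boolP (nz q); last by rewrite coef_not_nz.
by rewrite coef_mon //; case: eqP => // eq; rewrite eq eqxx in qb.
Qed.

(** The image [x] of [p] is killed by [b]. By surjectivity p' is a left multiple of [x], and [x]
    lies in R p', so comparing lengths shows that p' occurs in [x]; then b p' occurs in b x, which
    is 0. *)
Lemma no_epi_separated a b p p' : source a = source b ->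
  mon (arr a) * mon p != 0 -> mon (arr b) * mon p = 0 ->
  mon (arr b) * mon p' != 0 -> ~ epi_exists (Rm (mon p)) (Rm (mon p')).
Proof.
move=> ab ap bp bp' [phi sphi].
have [P eP] := Rm_ex (mon p) 1; have [P' eP'] := Rm_ex (mon p') 1.
have [Y eY] := sphi P'; have [s es] := RmP Y.
have Ys : Y = s *: P by apply: val_inj; rewrite linearZ /= eP mul1r.
pose x := Rm_val (phi P); have [r er] := RmP (phi P).
have bx : mon (arr b) * x = 0.
  have -> : mon (arr b) * x = Rm_val (phi (mon (arr b) *: P)).
    by rewrite linearZ.
  have -> : mon (arr b) *: P = 0 by apply: val_inj; rewrite linearZ /= eP mul1r.
  by rewrite linear0.
have sx : mon p' = s * x by rewrite -[LHS]mul1r -eP' -eY Ys linearZ.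
move: bp'; rewrite mon_mul; case c : (qcomp (arr b) p') => [u|] /=; last by rewrite eqxx.
move=> nzu; have [_ nzp'] := nz_qcomp c nzu.
have : coef p' (s * x) != 0 by rewrite -sx coef_mon // eqxx oner_neq0.
case/coef_mul=> t [w [c1 _ wx]].
have [w' c2 _] : exists2 w', qcomp w' p' = Some w & coef w' r != 0.
  by apply: coef_mul_mon; rewrite -er.
have ew : p' = w.
  apply: (qcomp_lenr c1); apply/eqP; rewrite eqn_leq (qcomp_len c1) leq_addr andbT.
  by rewrite -(qcomp_len c1) (qcomp_len c2) leq_addr.
by move: wx; rewrite -ew -(coef_monl presR x c nzu) bx linear0 eqxx.
Qed.

Lemma ordered_unique_out : ideally_ordered pi -> unique_out pi.
Proof.
move=> ord a b ab nza nzb; apply: contrapT => nab.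
have [p [ap bp]] := separating_path ab nab nza.
have [p' [bp' ap']] : exists p, mon (arr b) * mon p != 0 /\ mon (arr a) * mon p = 0.
  by apply: separating_path; [ | move=> e; apply: nab | ].
have [nzv _] := nz_lazy nza.
have endp c q : mon (arr c) * mon q != 0 -> qend q = source c.
  rewrite mon_mul; case cc : (qcomp (arr c) q) => [u|] /=; last by rewrite eqxx.
  by have [<- _ _ _] := qcomp_SomeP cc.
have ep := endp _ _ ap; have ep' := endp _ _ bp'.
have [||||E|E] := ord _ (primitive_lazy presR nzv) (mon p) (mon p').
- by exists p.
- by exists p'.
- by exists (mon p); rewrite lazy_mul ep eqxx.
- by exists (mon p'); rewrite lazy_mul ep' -ab eqxx.
- exact: no_epi_separated ab ap bp bp' E.
- exact: no_epi_separated (esym ab) bp' ap' ap E.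
Qed.

(* The leftmax paths are indexed by their start, and every nonzero vertex is *)
(* the end of one of them, so counting shows that it is the end of only one. *)
Lemma unique_out_unique_socle : unique_out pi -> unique_socle pi.
Proof.
move=> U q q' lq lq' e.
(* Vertices whose lazy path vanishes in [R] are sent to themselves, so that [G] is a self-map of the
   finite set of all vertices and injectivity gives bijectivity. *)
have HG w : exists v, if nz (lazy w) then exists2 p, leftmax p & qend p = w /\ qstart p = v
                      else v = w.
  have [nzw|nzw] := boolP (nz (lazy w)); last by exists w.
  by have [p lp ep] := leftmax_end_torsionless nzw; exists (qstart p), p.
have [G GP] := choice HG.
have injG : injective G.
  move=> w w' eG; have := GP w; have := GP w'; rewrite -eG.
  case: ifP => nzw'; case: ifP => nzw; last by move=> <-.
  - move=> [p' lp' [ep' sp']] [p lp [ep sp]]; rewrite -ep -ep'; congr qend.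
    by apply: (leftmax_unique U lp lp'); rewrite sp sp'.
  - by move=> [p' [/nz_lazy[h _] _] [_ sp']] ew; rewrite sp' ew nzw in h.
  - by move=> ew' [p [/nz_lazy[h _] _] [_ sp]]; rewrite sp ew' nzw' in h.
have start p : leftmax p -> G (qend p) = qstart p.
  move=> lp; have [w ew] : exists w, qstart p = G w.
    by have [G' _ G'K] := injF_bij injG; exists (G' (qstart p)).
  have [nzp _] := lp; have [nzs nze] := nz_lazy nzp.
  have := GP w; case: ifP => [nzw [r lr [er sr]]|nzw e'].
    rewrite ew -er; congr G; congr qend.
    by apply: (leftmax_unique U lp lr); rewrite ew sr.
  by rewrite ew e' nzw in nzs.
by apply: (leftmax_unique U lq lq'); rewrite -!start // e.
Qed.

Lemma torsionless_self_injective : ideally_ordered pi -> self_injective R.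
Proof.
move=> ord; apply: (@nondegenerate_form_self_injective k R (socle_form presR)) => x.
apply: socle_form_nondegenerate; apply: unique_out_unique_socle.
exact: ordered_unique_out.
Qed.

End TorsionlessIndecomposables.

(** * Self-injective monomial algebras *)

Section SelfInjectiveRing.
Variable R : pzRingType.
Hypothesis injR : self_injective R.

Lemma linear_regularE (g : {linear R^o -> R^o}) (x : R) : g x = x * g 1.
Proof. by rewrite -[RHS]linearZ; congr (g _); apply/esym/mulr1. Qed.

(** The map r m |-> r y on R m extends to [R], where it is right multiplication by its value at
    1. *)
Lemma self_injective_ann (m y : R) : (forall r, r * m = 0 -> r * y = 0) ->
  exists r, m * r = y.
Proof.
move=> ann; have [i ei] := Rm_val_ex m.
have [f ef] := @Rm_lift R m R^o y ann.
have inji : injective i by move=> x x'; rewrite !ei; apply: val_inj.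
have [g eg] := injR f (finitely_generated_Rm m) (finitely_generated_free1 R) inji.
have [x ex] := Rm_ex m 1; exists (g 1).
by have := eg x; rewrite (ef x 1 ex) ei ex mul1r scale1r linear_regularE.
Qed.

Lemma self_injective_independent (m n : R) :
  (forall r s, r * m = s * n -> r * m = 0) -> exists r, m * r = m /\ n * r = 0.
Proof.
move=> disj; have [i ei] := Rm_val_ex m; have [j ej] := Rm_val_ex n.
have [|z ez] := @mk_linear R (Rm n) R^o (fun=> 0).
  by move=> c x y; rewrite scaler0 addr0.
have ij0 x y : i x + j y = 0 -> x = 0 /\ y = 0.
  rewrite ei ej; have [r er] := RmP x; have [s es] := RmP y.
  move=> /eqP; rewrite addr_eq0 => /eqP exy.
  have x0 : Rm_val x = 0.
    by rewrite er; apply: (disj r (- s)); rewrite mulNr -er -es.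
  have y0 : Rm_val y = 0 by apply/eqP; rewrite -oppr_eq0 -exy x0.
  by split; apply: val_inj; rewrite /= ?x0 ?y0.
have [g [g1 g2]] := injective_extend_prod i z injR (finitely_generated_Rm m)
  (finitely_generated_Rm n) (finitely_generated_free1 R) ij0.
have [x ex] := Rm_ex m 1; have [y ey] := Rm_ex n 1; exists (g 1); split.
  by have := g1 x; rewrite ei ex mul1r linear_regularE.
by have := g2 y; rewrite ej ez ey mul1r linear_regularE.
Qed.

End SelfInjectiveRing.

Section SelfInjective.
Variables (k : fieldType) (Q : quiver) (S : qpath Q -> Prop) (R : falgType k).
Variable pi : {rmorphism pathalg k Q -> R}.
Variable presR : monomial_presentation S pi.
Hypothesis injR : self_injective R.
Implicit Types p q t u : qpath Q.
Local Notation mon := (mon pi).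
Local Notation nz := (nz pi).
Local Notation coef := (coef presR).
Local Notation leftmax := (leftmax pi).

(* If a and b leave the same vertex, then the map Ra + Rb -> R that is the    *)
(* identity on Ra and zero on Rb is right multiplication by some r, whose     *)
(* constant term would have to be both 1 and 0.                               *)
Lemma self_injective_unique_out : unique_out pi.
Proof.
move=> a b ab nza nzb; apply: contrapT => nab.
have disj (r s : R) : r * mon (arr a) = s * mon (arr b) -> r * mon (arr a) = 0.
  move=> e; apply/eqP; apply: contraT => /(coef_neq0 presR)[p pa].
  have [t ct _] := coef_mul_mon pa; move: pa; rewrite e => /coef_mul_mon[t' ct' _].
  have [_ _ et _] := qcomp_SomeP ct; have [_ _ et' _] := qcomp_SomeP ct'.
  by case: nab; move: et; rewrite et' => -[].
have [r [ga gb]] := self_injective_independent injR disj.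
have lz (c : arrow Q) : qcomp (arr c) (lazy (source c)) = Some (arr c).
  by rewrite qcomp_lazyr eqxx.
have := coef_monl presR r (lz a) nza; rewrite ga coef_mon // eqxx ab.
rewrite -(coef_monl presR r (lz b) nzb) gb linear0 => /eqP.
by rewrite oner_eq0.
Qed.

(** Maximal paths with a common end have the same left annihilator, so by [self_injective_ann] each
    is a right multiple of the other. Each is then a final segment of the other, and they
    coincide. *)
Lemma self_injective_unique_socle : unique_socle pi.
Proof.
have ext q q' : leftmax q -> leftmax q' -> qend q = qend q' ->
    exists t, qcomp q t = Some q'.
  move=> lq lq' e; have [nzq _] := lq; have [nzq' _] := lq'.
  have [r|r er] := @self_injective_ann R injR (mon q) (mon q').
    have rq := mon_leftmax presR r lq; have rq' := mon_leftmax presR r lq'.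
    move=> rq0; rewrite rq' -e; move: rq0; rewrite rq => /eqP.
    by rewrite scaler_eq0 (negPf nzq) orbF => /eqP->; exact: scale0r.
  have : coef q' (mon q * r) != 0 by rewrite er coef_mon // eqxx oner_neq0.
  by case/coef_mon_mul=> t c _; exists t.
move=> q q' lq lq' e; have [t c] := ext _ _ lq lq' e.
have [t' c'] := ext _ _ lq' lq (esym e); apply/esym; apply: (qcomp_lenl c).
apply/eqP; rewrite eqn_leq; apply/andP; split.
  by rewrite (qcomp_len c') leq_addl.
by rewrite (qcomp_len c) leq_addl.
Qed.

(** Sending a vertex to the end of a maximal path from it is injective by
    [self_injective_unique_socle], hence onto; vanishing vertices are fixed. *)
Lemma self_injective_leftmax_end w : nz (lazy w) -> exists2 q, leftmax q & qend q = w.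
Proof.
move=> nzw.
have HF v : exists w, if nz (lazy v) then exists2 p, leftmax p & qend p = w /\ qstart p = v
                      else v = w.
  have [nzv|nzv] := boolP (nz (lazy v)); last by exists v.
  by have [p lp sp] := leftmax_start presR nzv; exists (qend p), p.
have [F FP] := choice HF.
have injF : injective F.
  move=> v v' eF; have := FP v; have := FP v'; rewrite -eF.
  case: ifP => nzv'; case: ifP => nzv; last by move=> ->.
  - move=> [p' lp' [ep' sp']] [p lp [ep sp]]; rewrite -sp -sp'; congr qstart.
    by apply: self_injective_unique_socle => //; rewrite ep ep'.
  - by move=> [p' [/nz_lazy[_ h] _] [ep' _]] ev; rewrite ep' -ev nzv in h.
  - by move=> ev' [p [/nz_lazy[_ h] _] [ep _]]; rewrite ep -ev' nzv' in h.
have [F' _ F'K] := injF_bij injF; have := FP (F' w); rewrite F'K.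
case: ifP => [_ [q lq [eq _]]|nzF e]; first by exists q.
by rewrite e nzw in nzF.
Qed.

(* If p is a longest path acting nontrivially on M, say on m, then the socle *)
(* element p m corresponds to a maximal path q ending where p ends, q = p z, *)
(* and z -> m embeds Rz into M; this embedding splits because R is injective *)
(* and no path longer than p acts on M.                                      *)
Lemma self_injective_indecomposable (M : lmodType R) :
  finitely_generated M -> indecomposable M ->
  exists2 z, nz z & lmod_iso M (Rm (mon z)).
Proof.
move=> fgM iM; have U := self_injective_unique_out.
have [x xM] : exists x : M, x <> 0.
  apply: contrapT => h; have [M0 _] := iM; apply: M0 => x.
  by apply: contrapT => x0; apply: h; exists x.
have [|p [x0 [_ px0 pmax]]] := @max_path _ _ _ _ _ presR M (fun=> True).
  by exists x.
have kill t (y : M) : (qlen p < qlen t)%N -> mon t *: y = 0 by apply: pmax.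
pose m := mon (lazy (qstart p)) *: x0; pose y := mon p *: m; pose w := qend p.
have y0 : y <> 0 by rewrite /y scalerA mul_lazy eqxx.
have scal0 (c : k) : c%:A *: y = 0 -> c = 0.
  move=> cy; apply/eqP; apply: contraT => c0; case: y0.
  rewrite -[y]scale1r -[1](scale1r _) -(mulVf c0) -scalerA -mulr_algl.
  by rewrite -scalerA cy scaler0.
have nzp : nz p by apply/eqP => p0; apply: px0; rewrite p0 scale0r.
have [_ nzw] := nz_lazy nzp.
have [q lq eq] := self_injective_leftmax_end nzw; have [nzq _] := lq.
have ryE r : r *: y = (coef (lazy w) r)%:A *: y.
  apply: scale_socle; first by rewrite scalerA lazy_mul eqxx.
  move=> t t0; rewrite scalerA mon_mul; case c : (qcomp t p) => [r'|] /=; last exact: scale0r.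
  by apply: kill; rewrite (qcomp_len c) -[ltnLHS]addn0 ltn_add2l.
have qE r : r * mon q = coef (lazy w) r *: mon q by rewrite (mon_leftmax presR r lq) eq.
have [r|i0 i0E] := @Rm_lift R (mon q) M y.
  by rewrite qE ryE => /eqP; rewrite scaler_eq0 (negPf nzq) orbF => /eqP->; rewrite !scale0r.
have inj0 : injective i0.
  apply: linear_injective => X; have [r er] := RmP X; rewrite (i0E X r er) ryE => /scal0 r0.
  by apply: val_inj; rewrite /= er qE r0 scale0r.
have [f0 f0E] := Rm_val_ex (mon q).
(* [g0] extends the inclusion of R q along q |-> y = p m, whence p g0(m) = q. So [p] is a final
   segment of [q], and [z] is the initial segment that remains. *)
have [g0 g0E] := injR f0 (finitely_generated_Rm (mon q)) fgM inj0.
have g0y : mon p * g0 m = mon q.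
  have [X eX] := Rm_ex (mon q) 1; have := g0E X.
  by rewrite (i0E X 1 eX) f0E eX mul1r scale1r -[mon p * _]linearZ.
have [z cz _] : exists2 z, qcomp p z = Some q & coef z (g0 m) != 0.
  by apply: coef_mon_mul; rewrite g0y coef_mon // eqxx oner_neq0.
have [_ nzz] := nz_qcomp cz nzq; have [ez sq _ _] := qcomp_SomeP cz.
(* A path [t] acting on [m] starts where [p] does and is no longer, so it is a prefix of [p]. Then t
   z is a prefix of [q], hence nonzero, and its coefficient in r z is that of [t] in [r]. *)
have ann r : r * mon z = 0 -> r *: m = 0.
  move=> rz; rewrite (coefE presR r) scaler_suml; apply: big1_seq => t /andP[_].
  rewrite mem_nz_paths => nzt; have [tm|/eqP tm] := pselect (mon t *: m = 0).
    by rewrite -mulr_algl -scalerA tm scaler0.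
  have st : qstart t = qstart p.
    apply/eqP; apply: contraNT tm => /negPf st.
    by rewrite scalerA mul_lazy st scale0r.
  have le_tp : (qlen t <= qlen p)%N.
    by rewrite leqNgt; apply: contra tm => /kill->.
  have [t' ct'] := path_prefix U nzt nzp (esym st) le_tp.
  have [|u [cu _ _ _]] := @qcompP Q t z; first by rewrite st.
  have nzu : nz u.
    have := qcompA t' t z; rewrite cu ct' /= cz => c'.
    by have [] := nz_qcomp c' nzq.
  by rewrite -(coef_monr presR r cu nzu) rz linear0 !scale0r.
have [h hE] := Rm_lift ann.
(* A nonzero X = r z in the kernel has a left multiple t X = c q = c p z with c nonzero. Then t r -
   c p kills [z], hence [m]; as t r m = 0, this gives c y = 0. *)
have injh : injective h.
  apply: linear_injective => X hX; have [r er] := RmP X; apply: val_inj => /=.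
  apply/eqP; apply: contraT => /(socle_path presR)[t tX0 tX].
  have tXq u : coef u (mon t * Rm_val X) != 0 -> u = q.
    move=> uX; have [lu _] := tX u uX; apply: (leftmax_unique U lu lq).
    move: uX; rewrite er mulrA => /coef_mul_mon[s /qcomp_SomeP[_ -> _ _] _].
    by rewrite sq.
  have [u uX] := coef_neq0 presR tX0; have uq := tXq u uX; rewrite uq in uX.
  set c := coef q _ in uX.
  have tXE : mon t * Rm_val X = c *: mon q.
    apply: (@coef_eq _ _ _ _ _ presR) => u'; rewrite linearZ /=.
    have [->|u'q] := eqVneq u' q; first by rewrite coef_mon // eqxx -[RHS]/(_ * _) mulr1.
    have -> : coef u' (mon t * Rm_val X) = 0.
      by apply/eqP; apply: contraNT u'q => /tXq->.
    have [nzu'|nzu'] := boolP (nz u'); last by rewrite coef_not_nz // scaler0.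
    by rewrite coef_mon // (negPf u'q) scaler0.
  have e1 : mon t * r * mon z = c *: mon q by rewrite -mulrA -er.
  have e2 : (c *: mon p) * mon z = c *: mon q.
    by rewrite -scalerAl; congr (_ *: _); exact/esym/(mon_qcomp pi cz).
  have e3 : (mon t * r) *: m = 0 by rewrite -scalerA -(hE X r er) hX scaler0.
  have e4 : (c *: mon p) *: m = c%:A *: y by rewrite /y [RHS]scalerA mulr_algl.
  have /ann : (mon t * r - c *: mon p) * mon z = 0 by rewrite mulrBl e1 e2 subrr.
  rewrite scalerBl e3 sub0r e4 => /eqP; rewrite oppr_eq0 => /eqP/scal0 c0.
  by rewrite c0 eqxx in uX.
have [fz fzE] := Rm_val_ex (mon z).
have [g gE] := injR fz (finitely_generated_Rm (mon z)) fgM injh.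
(* [g] extends the inclusion of R z to [M]; multiplying by the idempotent at the start of [z] leaves
   only paths from that vertex, and it remains to see that they lie in R z. *)
pose G (x1 : M) : R := g x1 * mon (lazy (qstart z)).
have Rz x1 : exists X : Rm (mon z), Rm_val X = G x1.
  suff [r ->] : exists r, G x1 = r * mon z by exact: Rm_ex.
  rewrite (coefE presR (G x1)); apply: (@big_ind _ (fun a => exists r, a = r * mon z)).
  - by exists 0; rewrite mul0r.
  - by move=> _ _ [r ->] [s ->]; exists (r + s); rewrite mulrDl.
  move=> u _; have [->|uG] := eqVneq (coef u (G x1)) 0.
    by exists 0; rewrite mul0r scale0r.
  have nzu := coef_nz uG; have su : qstart u = qstart z.
    by have [s /qcomp_SomeP[_ -> _ _]] := coef_mul_mon uG.
  have [le_zu|lt_uz] := leqP (qlen z) (qlen u).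
    have [t ct] := path_prefix U nzz nzu su le_zu.
    exists ((coef u (G x1))%:A * mon t).
    by rewrite (mon_qcomp pi ct) -mulrA mulr_algl.
  (* If [u] is shorter than z = t u, then p t is longer than [p] and kills [M]. But q = p t u would
     occur in p t times G x1 with the coefficient of [u]. *)
  have [t ct] := path_prefix U nzu nzz (esym su) (ltnW lt_uz).
  have := qcompA p t u; rewrite ct /= cz; case cpt : (qcomp p t) => [pt|] //= /esym c'.
  have ptG : mon pt * G x1 = 0.
    rewrite mulrA -[mon pt * _]linearZ kill ?linear0 ?mul0r //.
    rewrite (qcomp_len cpt) -[ltnLHS]add0n ltn_add2r lt0n.
    by apply: contraTneq lt_uz => t0; rewrite (qcomp_len ct) t0 addn0 ltnn.
  by move: uG; rewrite -(coef_monl presR (G x1) c' nzq) ptG linear0 eqxx.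
have [rho' rhoE] := choice Rz.
have [|rho erho] := @mk_linear R M _ rho'.
  move=> a b c; apply: val_inj; rewrite linearP /= !rhoE /G linearP mulrDl.
  by rewrite -mulrA.
have rhoK : cancel h rho.
  move=> X; apply: val_inj; rewrite /= erho rhoE /G gE fzE.
  by have [r ->] := RmP X; rewrite -mulrA mul_lazy eqxx.
exists z; first exact: nzz.
apply: (indecomposable_retract rhoK iM) => Z0; have [X eX] := Rm_ex (mon z) 1.
by move/eqP: nzz; apply; rewrite -[mon z]mul1r -eX (Z0 X).
Qed.

End SelfInjective.

(** * The equivalence *)

Theorem proposition6p18 (k : closedFieldType) (Q : quiver)
    (S : qpath Q -> Prop) (R : falgType k)
    (pi : {rmorphism pathalg k Q -> R})
    (R_monomial : monomial_presentation S pi)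
    (R_ordered : ideally_ordered pi) :
  (finite_representation_type R /\
   exists AUS SUB : lmodType R,
     [/\ is_AUS AUS, is_SUB SUB & endo_alg_iso AUS SUB])
  <-> self_injective R.
Proof.
split=> [[_ [AUS [SUB [isA isS iso]]]]|injR].
  apply: (torsionless_self_injective R_monomial) => // U.
  exact: indecomposables_in_sub isA isS iso U.
have cls := @self_injective_indecomposable k Q S R pi R_monomial injR.
pose l := nz_paths R_monomial.
pose M (i : 'I_(size l)) : lmodType R := Rm (mon pi (tnth (in_tuple l) i)).
have cov (U : lmodType R) : finitely_generated U -> indecomposable U ->
    exists i, lmod_iso U (M i).
  move=> fgU iU; have [z nzz isoU] := cls U fgU iU.
  have : z \in in_tuple l by rewrite mem_nz_paths.
  by case/tnthP=> i ez; exists i; rewrite /M -ez.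
have sub_fg (U : lmodType R) : indecomposable U -> in_sub U <-> finitely_generated U.
  move=> iU; split; first exact: in_sub_finitely_generated.
  move=> fgU; have [z _ /lmod_iso_inv[f [g [fg _]]]] := cls U fgU iU.
  have [j ej] := Rm_val_ex (mon pi z).
  have [|F eF] := @mk_linear R U R^o (j \o f).
    by move=> a x y; rewrite /= !linearP.
  apply: (@in_sub_submodule_free _ _ F) => x y; rewrite !eF /= !ej => e.
  by apply: (can_inj fg); apply: val_inj.
(* By [sub_fg], finitely generated modules and sub(R) have the same indecomposables, so [X] is both
   AUS and SUB and the identity is the required isomorphism. *)
have [X [n [N [Nfg Ninj Ncov isoX]]]] := sum_of_indecomposables_ex cov.
split; first by exists (size l), M.
exists X, X; split.
- by exists n, N.
- exists n, N; split=> // [i|U subU iU].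
    by have [fgi ii] := Nfg i; split=> //; apply/sub_fg.
  by apply: Ncov => //; apply/sub_fg.
by exists idfun; split=> //; exists idfun.
Qed.
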